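(* Let $\mathfrak g$ be a Lie algebra and let $A$ be a $\mathfrak g$-module endowed with the structure of a unital commutative associative algebra on which $\mathfrak g$ acts by derivations. (a) The operators $\iota_f$, $f\in A$, and $\iota_X$, $X\in\mathfrak g$, on $\Delta^\bullet(\mathfrak g,A)$ (multiplication by $f$, respectively $(\iota_X\omega)(Y)=\omega(X\wedge Y)$) define (via $\iota_{f\otimes X}=\iota_f\iota_X$) a structure of an $(A\otimes\mathfrak g,A)$-complex on $(\Delta^\bullet(\mathfrak g,A),d)$. (b) This extends uniquely to a $\mathbb Z_+$-graded calculus structure of the Gerstenhaber algebra $\Delta_\bullet(\mathfrak g,A)$ on the complex $\Delta^\bullet(\mathfrak g,A)$.
   Context: $\mathbb F$ is a field of characteristic $0$; tensor products are over $\mathbb F$. For a vector superspace $V$ with parity $p$, $\Pi V$ is the same space with reversed parity. $\mathrm{End}(V)$ is a Lie superalgebra with $[P,Q]=PQ-(-1)^{p(P)p(Q)}QP$. A *complex* $(\Omega,d)$ is a vector superspace with an odd endomorphism $d$, $d^2=0$. A *Lie superalgebroid* $(\mathfrak l,A)$: $\mathfrak l$ is a Lie superalgebra, $A$ is a (purely even) commutative associative algebra, $\mathfrak l$ is a left $A$-module, $A$ is a left $\mathfrak l$-module, and $(fX)(g)=f(X(g))$, $X(fg)=X(f)g+fX(g)$, $[X,fY]=X(f)Y+f[X,Y]$. Here $(A\otimes\mathfrak g,A)$ is the Lie algebroid with bracket $[f\otimes X,g\otimes Y]=fg\otimes[X,Y]+fX(g)\otimes Y-gY(f)\otimes X$ and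 action $(f\otimes X)(g)=fX(g)$. The Lie superalgebra $\mathfrak l\ltimes\Pi A$ is $\mathfrak l\oplus\Pi A$ with bracket extending that of $\mathfrak l$ by $[f,g]=0$, $[X,f]=X(f)$ and skewcommutativity. For a Lie superalgebra $\mathfrak h$, an *$\mathfrak h$-complex* is a complex $(\Omega,d)$ with an even linear map $\iota_\cdot:\Pi\mathfrak h\to\mathrm{End}(\Omega)$ such that $[\iota_X,\iota_Y]=0$ and $[[\iota_X,d],\iota_Y]=\iota_{[X,Y]}$. An *$(\mathfrak l,A)$-complex* is a $\mathfrak l\ltimes\Pi A$-complex whose map $\iota_\cdot:\Pi\mathfrak l\oplus A\to\mathrm{End}(\Omega)$ satisfies $\iota_{fg}=\iota_f\iota_g$ and $\iota_{fX}=\iota_f\iota_X$. A *Gerstenhaber algebra* is a vector superspace $\mathcal G$ with parity $p$, a product $\wedge$ and a bracket such that $(\mathcal G,\wedge)$ is a commutative associative superalgebra, $(\Pi\mathcal G,[\cdot,\cdot])$ is a Lie superalgebra, and $[X,Y\wedge Z]=[X,Y]\wedge Z+(-1)^{(p(X)+\bar 1)p(Y)}Y\wedge[X,Z]$. It is $\mathbb Z_+$-graded if $\mathcal G=\bigoplus_{n\ge0}\mathcal G_n$ with $\mathcal G_m\wedge\mathcal G_n\subset\mathcal G_{m+n}$, $[\mathcal G_m,\mathcal G_n]\subset\mathcal G_{m+n-1}$. For a Lie superalgebroid $(\mathfrak l,A)$, $S_A(\Pi\mathfrak l)$ is a $\mathbb Z_+$-graded Gerstenhaber algebra: $\wedge$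 is the product of the symmetric superalgebra over $A$ and the bracket (Schouten bracket) is the unique Gerstenhaber bracket extending that of $\mathfrak l\ltimes\Pi A$. A *calculus structure* of $\mathcal G$ on a complex $(\Omega,d)$ is a module structure $X\mapsto\iota_X$ of $\Omega$ over the superalgebra $(\mathcal G,\wedge)$ and a module structure $X\mapsto L_X$ over the Lie superalgebra $(\Pi\mathcal G,[\cdot,\cdot])$, with $[L_X,\iota_Y]=\iota_{[X,Y]}$ and $L_X=[\iota_X,d]$ for all $X,Y\in\mathcal G$. If $\Omega=\bigoplus_{n\geq 0}\Omega^n$ with $d\Omega^{n}\subset\Omega^{n+1}$, it is $\mathbb Z_+$-graded if $\iota_X\Omega^n\subset\Omega^{n-m}$ and $L_X\Omega^n\subset\Omega^{n-m+1}$ for $X\in\mathcal G_m$ (with $\Omega^n=0$ for $n<0$). ''Extends'' means that the contraction restricts to the given $\iota$ on $\Pi(A\otimes\mathfrak g)\oplus A$. Chains: $\Delta_\bullet(\mathfrak g,A)=S_A(\Pi(A\otimes\mathfrak g))=A\otimes\bigwedge\mathfrak g$, with the $\mathbb Z_+$-graded Gerstenhaber algebra structure of $S_A(\Pi\mathfrak l)$ for the Lie algebroid $(\mathfrak l,A)=(A\otimes\mathfrak g,A)$, i.e. $\wedge$ is the product of the symmetric superalgebra over $A$ and the bracket is the Schouten bracket, the unique Gerstenhaber bracket extending the bracket of $(A\otimes\mathfrak g)\ltimes\Pi A$. Cochains: $\Delta^k(\mathfrak g,A)=\mathrm{Hom}_A(\Delta_k(\mathfrak g,A),A)=\mathrm{Hom}_{\mathbb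 F}(\bigwedge^k\mathfrak g,A)$, $\Delta^\bullet=\bigoplus_{k\ge0}\Delta^k$ with parity induced by the grading, and differential, for $X_i\in\mathfrak g$, $$(d\omega)(X_1\wedge\dots\wedge X_{k+1})=\sum_{i=1}^{k+1}(-1)^{i+1}X_i\big(\omega(X_1\wedge\cdots\widehat{X_i}\cdots\wedge X_{k+1})\big)+\sum_{i<j}(-1)^{i+j}\omega([X_i,X_j]\wedge X_1\wedge\cdots\widehat{X_i}\cdots\widehat{X_j}\cdots\wedge X_{k+1}).$$ For $f\in A$, $\iota_f$ is multiplication by $f$ on $\mathrm{Hom}_{\mathbb F}(\bigwedge\mathfrak g,A)$. For $X\in\mathfrak g$, $\iota_X:\Delta^k\to\Delta^{k-1}$ is $0$ for $k=0$ and $(\iota_X\omega)(Y)=\omega(X\wedge Y)$, $Y\in\bigwedge^{k-1}\mathfrak g$, for $k\ge1$. *)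

(* Defs.v *)
From HB Require Import structures.
From mathcomp Require Import all_boot all_order all_algebra.
From mathcomp Require Import generic_quotient.
From mathcomp Require Import ring.
From mathcomp Require Import boolp classical_sets functions.

Set Implicit Arguments.
Unset Strict Implicit.
Unset Printing Implicit Defensive.

Import GRing.Theory.
Local Open Scope classical_set_scope.
Local Open Scope quotient_scope.
Local Open Scope ring_scope.

(* Restriction of scalars along [F -> A]. *)

Definition res (F : fieldType) (A : comAlgType F) (M : lmodType A) : Type := M.

Section Res.
Variables (F : fieldType) (A : comAlgType F) (M : lmodType A).

HB.instance Definition _ := GRing.Zmodule.on (res M).

Let res_scale (c : F) (x : res M) : res M := c%:A *: (x : M).

Fact res_scaleA a b v : res_scale a (res_scale b v) = res_scale (a * b) v.
Proof. by rewrite /res_scale !scalerA -scalerAl mul1r scalerA. Qed.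
Fact res_scale1 : left_id 1 res_scale.
Proof. by move=> v; rewrite /res_scale !scale1r. Qed.
Fact res_scaleDr : right_distributive res_scale +%R.
Proof. by move=> a u v; rewrite /res_scale scalerDr. Qed.
Fact res_scaleDl v : {morph res_scale^~ v : a b / a + b}.
Proof. by move=> a b; rewrite /res_scale !scalerDl. Qed.

HB.instance Definition _ := GRing.Zmodule_isLmodule.Build F (res M)
  res_scaleA res_scale1 res_scaleDr res_scaleDl.

End Res.

(* The A-module A (x)_F V: terms modulo the least congruence containing the
   abelian group axioms and F-bilinearity of the pure tensors. *)

Section Tensor.
Variables (F : fieldType) (A : comAlgType F) (V : lmodType F).

Inductive tterm := TZero | TPure of A & V | TAdd of tterm & tterm.

Inductive tcong : tterm -> tterm -> Prop :=
| tcong_refl t : tcong t t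
| tcong_sym t u : tcong t u -> tcong u t
| tcong_trans t u v : tcong t u -> tcong u v -> tcong t v
| tcong_add t t' u u' :
    tcong t t' -> tcong u u' -> tcong (TAdd t u) (TAdd t' u')
| tcong_addA t u v : tcong (TAdd t (TAdd u v)) (TAdd (TAdd t u) v)
| tcong_addC t u : tcong (TAdd t u) (TAdd u t)
| tcong_add0 t : tcong (TAdd TZero t) t
| tcong_pure0 x : tcong (TPure 0 x) TZero
| tcong_pureDl a b x : tcong (TPure (a + b) x) (TAdd (TPure a x) (TPure b x))
| tcong_pureDr a x y : tcong (TPure a (x + y)) (TAdd (TPure a x) (TPure a y))
| tcong_pureZ (c : F) a x : tcong (TPure (c *: a) x) (TPure a (c *: x)).

HB.instance Definition _ := gen_eqMixin tterm.
HB.instance Definition _ := gen_choiceMixin tterm.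

Let tcongb (t u : tterm) : bool := `[< tcong t u >].

Fact tcongb_equiv : equiv_class_of tcongb.
Proof.
split=> [t|t u|u t v].
- by apply/asboolP; exact: tcong_refl.
- by apply/asboolP/asboolP; apply: tcong_sym.
- by move=> /asboolP tu /asboolP uv; apply/asboolP; apply: tcong_trans tu uv.
Qed.
Canonical tcong_equiv := EquivRelPack tcongb_equiv.
Definition tensor : Type := {eq_quot tcong_equiv}.
HB.instance Definition _ := Choice.on tensor.

Let tpi (t : tterm) : tensor := \pi_({eq_quot tcong_equiv}) t.
Let trepr (x : tensor) : tterm := repr (x : {eq_quot tcong_equiv}).

Let tpiP t u : tpi t = tpi u <-> tcong t u.
Proof. by split=> [/eqmodP/asboolP|h]; last by apply/eqmodP/asboolP. Qed.
Let treprK x : tpi (trepr x) = x. Proof. exact: reprK. Qed.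
Let trepr_pi t : tcong (trepr (tpi t)) t.
Proof. by apply/tpiP; rewrite treprK. Qed.

Fixpoint tscale (a : A) (t : tterm) : tterm :=
  match t with
  | TZero => TZero
  | TPure b x => TPure (a * b) x
  | TAdd t u => TAdd (tscale a t) (tscale a u)
  end.

Let tscaleP a t u : tcong t u -> tcong (tscale a t) (tscale a u).
Proof.
elim=> {t u} /=.
- by move=> t; exact: tcong_refl.
- by move=> t u _; exact: tcong_sym.
- by move=> t u v _ h1 _ h2; apply: tcong_trans h1 h2.
- by move=> t t' u u' _ h1 _ h2; exact: tcong_add.
- by move=> t u v; exact: tcong_addA.
- by move=> t u; exact: tcong_addC.
- by move=> t; exact: tcong_add0.
- by move=> x; rewrite mulr0; exact: tcong_pure0.
- by move=> b c x; rewrite mulrDr; exact: tcong_pureDl.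
- by move=> b x y; exact: tcong_pureDr.
- by move=> c b x; rewrite -scalerAr; exact: tcong_pureZ.
Qed.

Definition pure (a : A) (x : V) : tensor := tpi (TPure a x).
Let add (x y : tensor) : tensor := tpi (TAdd (trepr x) (trepr y)).
Let scale (a : A) (x : tensor) : tensor := tpi (tscale a (trepr x)).
Let opp (x : tensor) : tensor := scale (-1) x.
Let zero : tensor := tpi TZero.

Let piD t u : tpi (TAdd t u) = add (tpi t) (tpi u).
Proof. by apply/tpiP/tcong_add; apply/tcong_sym/trepr_pi. Qed.
Let piZ a t : tpi (tscale a t) = scale a (tpi t).
Proof. by apply/tpiP/tscaleP/tcong_sym/trepr_pi. Qed.

Fact tensor_addA : associative add.
Proof.
move=> x y z; rewrite -(treprK x) -(treprK y) -(treprK z) -!piD.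
by apply/tpiP; exact: tcong_addA.
Qed.
Fact tensor_addC : commutative add.
Proof.
by move=> x y; rewrite -(treprK x) -(treprK y) -!piD; apply/tpiP; exact: tcong_addC.
Qed.
Fact tensor_add0 : left_id zero add.
Proof. by move=> x; rewrite -(treprK x) -piD; apply/tpiP; exact: tcong_add0. Qed.
Let scaleDl' x : {morph scale^~ x : a b / a + b >-> add a b}.
Proof.
move=> a b; rewrite -(treprK x); elim: (trepr x) => [|c v|t IHt u IHu].
- by rewrite -!piZ /= -!piD; apply/tpiP/tcong_sym; exact: tcong_add0.
- by rewrite -!piZ /= -!piD mulrDl; apply/tpiP; exact: tcong_pureDl.
- rewrite -!piZ /= !piD !piZ IHt IHu.
  by rewrite -!tensor_addA; congr add; rewrite !tensor_addA; congr add;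
     rewrite tensor_addC.
Qed.
Let scale1' : left_id 1 scale.
Proof.
move=> x; rewrite -(treprK x) -piZ; congr tpi.
by elim: (trepr x) => //= [c v|t -> u ->]; rewrite ?mul1r.
Qed.
Let scale0' x : scale 0 x = zero.
Proof.
rewrite -(treprK x); elim: (trepr x) => [|c v|t IHt u IHu]; rewrite -!piZ //=.
  by rewrite mul0r; apply/tpiP; exact: tcong_pure0.
by rewrite piD !piZ IHt IHu tensor_add0.
Qed.
Fact tensor_addN : left_inverse zero opp add.
Proof. by move=> x; rewrite -{2}(scale1' x) -scaleDl' addNr scale0'. Qed.

HB.instance Definition _ := GRing.isZmodule.Build tensor
  tensor_addA tensor_addC tensor_add0 tensor_addN.

Fact tensor_scaleA a b x : scale a (scale b x) = scale (a * b) x.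
Proof.
rewrite -(treprK x) -!piZ; congr tpi.
by elim: (trepr x) => //= [c v|t -> u ->]; rewrite ?mulrA.
Qed.
Fact tensor_scaleDr : right_distributive scale +%R.
Proof.
move=> a x y; rewrite -(treprK x) -(treprK y).
by rewrite -[tpi _ + _]piD -!piZ /= piD.
Qed.

HB.instance Definition _ := GRing.Zmodule_isLmodule.Build A tensor
  tensor_scaleA scale1' tensor_scaleDr scaleDl'.

Lemma pureDl a b x : pure (a + b) x = pure a x + pure b x.
Proof. by rewrite -[RHS]piD; apply/tpiP; exact: tcong_pureDl. Qed.
Lemma pureDr a x y : pure a (x + y) = pure a x + pure a y.
Proof. by rewrite -[RHS]piD; apply/tpiP; exact: tcong_pureDr. Qed.
Lemma pureZ (c : F) a x : pure (c *: a) x = pure a (c *: x).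
Proof. by apply/tpiP; exact: tcong_pureZ. Qed.
Lemma scale_pure a b x : a *: pure b x = pure (a * b) x.
Proof. by rewrite -[LHS]piZ. Qed.
Lemma pure0 x : pure 0 x = 0.
Proof. by apply/tpiP; exact: tcong_pure0. Qed.

Lemma tensor_ind (P : tensor -> Prop) :
  P 0 -> (forall a x, P (pure a x)) ->
  (forall u v, P u -> P v -> P (u + v)) -> forall u, P u.
Proof.
move=> P0 Pp PD u; rewrite -(treprK u).
by elim: (trepr u) => // t Pt v Pv; rewrite piD; apply: PD.
Qed.

Section Lift.
Variable W : zmodType.

Definition balanced (b : A -> V -> W) : Prop :=
  [/\ forall a a' x, b (a + a') x = b a x + b a' x,
      forall a x x', b a (x + x') = b a x + b a x'
    & forall (c : F) a x, b (c *: a) x = b a (c *: x)].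

Fixpoint teval (b : A -> V -> W) (t : tterm) : W :=
  match t with
  | TZero => 0
  | TPure a x => b a x
  | TAdd t u => teval b t + teval b u
  end.

(* The map a (x) x |-> b a x, provided b is balanced. *)
Definition tlift (b : A -> V -> W) (u : tensor) : W := teval b (trepr u).

Variables (b : A -> V -> W) (bP : balanced b).

Let teval_cong t u : tcong t u -> teval b t = teval b u.
Proof.
case: bP => bDl bDr bZ; elim=> {t u} /= //.
- by move=> t u v _ -> _ ->.
- by move=> t t' u u' _ -> _ ->.
- by move=> t u v; rewrite addrA.
- by move=> t u; rewrite addrC.
- by move=> t; rewrite add0r.
- by move=> x; apply: (addIr (b 0 x)); rewrite -bDl !add0r.
Qed.

Let tlift_pi t : tlift b (tpi t) = teval b t.
Proof. exact/teval_cong/trepr_pi. Qed.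

Lemma tlift_pure a x : tlift b (pure a x) = b a x.
Proof. exact: tlift_pi. Qed.
Lemma tliftD : {morph tlift b : u v / u + v}.
Proof.
by move=> u v; rewrite -(treprK u) -(treprK v) -[tpi _ + _]piD !tlift_pi.
Qed.
Lemma tlift0 : tlift b 0 = 0.
Proof. exact: tlift_pi. Qed.

End Lift.
End Tensor.

(* The symmetric superalgebra S_R(Pi M) of the purely odd R-superspace Pi M,
   where M is an R-module: generators M and relations making M -> S_R(Pi M)
   R-linear and its values pairwise anticommuting. *)

Section Sym.
Variables (R : comNzRingType) (M : lmodType R).

Inductive sterm :=
  SCst of R | SGen of M | SAdd of sterm & sterm | SMul of sterm & sterm.

Inductive scong : sterm -> sterm -> Prop :=
| scong_refl t : scong t t
| scong_sym t u : scong t u -> scong u t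
| scong_trans t u v : scong t u -> scong u v -> scong t v
| scong_add t t' u u' :
    scong t t' -> scong u u' -> scong (SAdd t u) (SAdd t' u')
| scong_mul t t' u u' :
    scong t t' -> scong u u' -> scong (SMul t u) (SMul t' u')
| scong_addA t u v : scong (SAdd t (SAdd u v)) (SAdd (SAdd t u) v)
| scong_addC t u : scong (SAdd t u) (SAdd u t)
| scong_add0 t : scong (SAdd (SCst 0) t) t
| scong_mulA t u v : scong (SMul t (SMul u v)) (SMul (SMul t u) v)
| scong_mul0 t : scong (SMul (SCst 0) t) (SCst 0)
| scong_mul1 t : scong (SMul (SCst 1) t) t
| scong_mulDl t u v : scong (SMul (SAdd t u) v) (SAdd (SMul t v) (SMul u v))
| scong_mulDr t u v : scong (SMul t (SAdd u v)) (SAdd (SMul t u) (SMul t v))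
| scong_cstD r s : scong (SCst (r + s)) (SAdd (SCst r) (SCst s))
| scong_cstM r s : scong (SCst (r * s)) (SMul (SCst r) (SCst s))
| scong_cstC r t : scong (SMul (SCst r) t) (SMul t (SCst r))
| scong_genD x y : scong (SGen (x + y)) (SAdd (SGen x) (SGen y))
| scong_genZ r x : scong (SGen (r *: x)) (SMul (SCst r) (SGen x))
| scong_anti x y :
    scong (SAdd (SMul (SGen x) (SGen y)) (SMul (SGen y) (SGen x))) (SCst 0).

HB.instance Definition _ := gen_eqMixin sterm.
HB.instance Definition _ := gen_choiceMixin sterm.

Let scongb (t u : sterm) : bool := `[< scong t u >].

Fact scongb_equiv : equiv_class_of scongb.
Proof.
split=> [t|t u|u t v].
- by apply/asboolP; exact: scong_refl.
- by apply/asboolP/asboolP; apply: scong_sym.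
- by move=> /asboolP tu /asboolP uv; apply/asboolP; apply: scong_trans tu uv.
Qed.
Canonical scong_equiv := EquivRelPack scongb_equiv.
Definition sym : Type := {eq_quot scong_equiv}.
HB.instance Definition _ := Choice.on sym.

Definition spi (t : sterm) : sym := \pi_({eq_quot scong_equiv}) t.
Definition srepr (x : sym) : sterm := repr (x : {eq_quot scong_equiv}).

Lemma spiP t u : spi t = spi u <-> scong t u.
Proof. by split=> [/eqmodP/asboolP|h]; last by apply/eqmodP/asboolP. Qed.
Lemma sreprK x : spi (srepr x) = x. Proof. exact: reprK. Qed.
Lemma srepr_pi t : scong (srepr (spi t)) t.
Proof. by apply/spiP; rewrite sreprK. Qed.

Definition sgen (x : M) : sym := spi (SGen x).
Let add (x y : sym) : sym := spi (SAdd (srepr x) (srepr y)).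
Let mul (x y : sym) : sym := spi (SMul (srepr x) (srepr y)).
Let cst (r : R) : sym := spi (SCst r).
Let scale (r : R) (x : sym) : sym := mul (cst r) x.
Let opp (x : sym) : sym := scale (-1) x.

Let piD t u : spi (SAdd t u) = add (spi t) (spi u).
Proof. by apply/spiP/scong_add; apply/scong_sym/srepr_pi. Qed.
Let piM t u : spi (SMul t u) = mul (spi t) (spi u).
Proof. by apply/spiP/scong_mul; apply/scong_sym/srepr_pi. Qed.

Fact sym_addA : associative add.
Proof.
move=> x y z; rewrite -(sreprK x) -(sreprK y) -(sreprK z) -!piD.
by apply/spiP; exact: scong_addA.
Qed.
Fact sym_addC : commutative add.
Proof.
by move=> x y; rewrite -(sreprK x) -(sreprK y) -!piD; apply/spiP; exact: scong_addC.
Qed.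
Fact sym_add0 : left_id (cst 0) add.
Proof. by move=> x; rewrite -(sreprK x) -piD; apply/spiP; exact: scong_add0. Qed.
Fact sym_mulA : associative mul.
Proof.
move=> x y z; rewrite -(sreprK x) -(sreprK y) -(sreprK z) -!piM.
by apply/spiP; exact: scong_mulA.
Qed.
Fact sym_mul1 : left_id (cst 1) mul.
Proof. by move=> x; rewrite -(sreprK x) -piM; apply/spiP; exact: scong_mul1. Qed.
Let cstC r x : mul (cst r) x = mul x (cst r).
Proof. by rewrite -(sreprK x) -!piM; apply/spiP; exact: scong_cstC. Qed.
Fact sym_mulr1 : right_id (cst 1) mul.
Proof. by move=> x; rewrite -cstC sym_mul1. Qed.
Fact sym_mulDl : left_distributive mul add.
Proof.
move=> x y z; rewrite -(sreprK x) -(sreprK y) -(sreprK z) -piD -!piM -piD.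
by apply/spiP; exact: scong_mulDl.
Qed.
Fact sym_mulDr : right_distributive mul add.
Proof.
move=> x y z; rewrite -(sreprK x) -(sreprK y) -(sreprK z) -piD -!piM -piD.
by apply/spiP; exact: scong_mulDr.
Qed.
Let cstD r s : cst (r + s) = add (cst r) (cst s).
Proof. by rewrite -piD; apply/spiP; exact: scong_cstD. Qed.
Let cstM r s : cst (r * s) = mul (cst r) (cst s).
Proof. by rewrite -piM; apply/spiP; exact: scong_cstM. Qed.
Fact sym_addN : left_inverse (cst 0) opp add.
Proof.
move=> x; rewrite -{2}(sym_mul1 x) -sym_mulDl -cstD addNr.
by rewrite -(sreprK x) -piM; apply/spiP; exact: scong_mul0.
Qed.

HB.instance Definition _ := GRing.isZmodule.Build sym
  sym_addA sym_addC sym_add0 sym_addN.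

(* The augmentation, which shows that 1 != 0. *)
Let aug (t : sterm) : R :=
  (fix aug t := match t with
   | SCst r => r
   | SGen _ => 0
   | SAdd t u => aug t + aug u
   | SMul t u => aug t * aug u
   end) t.
Let augP t u : scong t u -> aug t = aug u.
Proof.
elim=> {t u} //=.
- by move=> t u v _ -> _ ->.
- by move=> t t' u u' _ -> _ ->.
- by move=> t t' u u' _ -> _ ->.
- by move=> *; rewrite addrA.
- by move=> *; rewrite addrC.
- by move=> *; rewrite add0r.
- by move=> *; rewrite mulrA.
- by move=> *; rewrite mul0r.
- by move=> *; rewrite mul1r.
- by move=> *; rewrite mulrDl.
- by move=> *; rewrite mulrDr.
- by move=> *; rewrite mulrC.
- by move=> *; rewrite addr0.
- by move=> *; rewrite mulr0.
- by move=> *; rewrite mulr0 addr0.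
Qed.
Fact sym_1neq0 : cst 1 != 0 :> sym.
Proof. by apply/eqP => /spiP/augP/eqP; rewrite oner_eq0. Qed.

HB.instance Definition _ := GRing.Zmodule_isNzRing.Build sym
  sym_mulA sym_mul1 sym_mulr1 sym_mulDl sym_mulDr sym_1neq0.

Fact sym_scaleA r s x : scale r (scale s x) = scale (r * s) x.
Proof. by rewrite /scale sym_mulA -cstM. Qed.
Fact sym_scaleDl x : {morph scale^~ x : r s / r + s}.
Proof. by move=> r s; rewrite /scale cstD sym_mulDl. Qed.

HB.instance Definition _ := GRing.Zmodule_isLmodule.Build R sym
  sym_scaleA sym_mul1 (fun r => sym_mulDr (cst r)) sym_scaleDl.

Fact sym_scaleAl r (x y : sym) : r *: (x * y) = r *: x * y.
Proof. exact: sym_mulA. Qed.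
HB.instance Definition _ := GRing.Lmodule_isLalgebra.Build R sym sym_scaleAl.

Fact sym_scaleAr r (x y : sym) : r *: (x * y) = x * (r *: y).
Proof.
change (mul (cst r) (mul x y) = mul x (mul (cst r) y)).
by rewrite !sym_mulA (cstC r x).
Qed.
HB.instance Definition _ := GRing.Lalgebra_isAlgebra.Build R sym sym_scaleAr.

Lemma spiD t u : spi (SAdd t u) = spi t + spi u. Proof. exact: piD. Qed.
Lemma spiM t u : spi (SMul t u) = spi t * spi u. Proof. exact: piM. Qed.
Lemma spiC r : spi (SCst r) = r%:A.
Proof. by rewrite -{1}(mulr1 r); exact: cstM. Qed.

Lemma sgenP r x y : sgen (r *: x + y) = r *: sgen x + sgen y.
Proof.
have -> : r *: sgen x = sgen (r *: x).
  by rewrite -[LHS]piM; apply/spiP/scong_sym/scong_genZ.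
by rewrite -[RHS]piD; apply/spiP/scong_genD.
Qed.

Lemma sgen_anti x y : sgen x * sgen y = - (sgen y * sgen x).
Proof.
apply/eqP; rewrite -addr_eq0; apply/eqP.
have -> : sgen x * sgen y = spi (SMul (SGen x) (SGen y)) by rewrite piM.
have -> : sgen y * sgen x = spi (SMul (SGen y) (SGen x)) by rewrite piM.
by rewrite -[LHS]piD; apply/spiP/scong_anti.
Qed.

(* The degree n component: R-combinations of products of n generators. *)
Definition sdeg (n : nat) : set sym :=
  [set u | exists (m : nat) (r : 'I_m -> R) (x : 'I_m -> 'I_n -> M),
     u = \sum_(i < m) r i *: \prod_(j < n) sgen (x i j)].

End Sym.

(* Superspaces over F: [p false] and [p true] are the even and the odd part.
   Bilinear identities involving signs are stated on homogeneous elements. *)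

Section Super.
Variable F : fieldType.

Definition is_submod (V : lmodType F) (P : set V) : Prop :=
  P 0 /\ forall (c : F) u v, P u -> P v -> P (c *: u + v).

Record is_superspace (V : lmodType F) (p : bool -> set V) : Prop := {
  super_submod b : is_submod (p b);
  super_sum v : exists v0 v1, [/\ p false v0, p true v1 & v = v0 + v1];
  super_direct v : p false v -> p true v -> v = 0
}.

(* V is the direct sum of the gr n, n : nat. *)
Record is_grading (V : lmodType F) (gr : nat -> set V) : Prop := {
  grading_submod n : is_submod (gr n);
  grading_sum v : exists (N : nat) (y : nat -> V),
    (forall n, gr n (y n)) /\ v = \sum_(n < N) y n;
  grading_direct (N : nat) (y : nat -> V) : (forall n, gr n (y n)) ->
    \sum_(n < N) y n = 0 -> forall n, (n < N)%N -> y n = 0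
}.

(* The component of degree n - m, which is zero when n < m. *)
Definition gr_sub (V : lmodType F) (gr : nat -> set V) (n m : nat) : set V :=
  if (m <= n)%N then gr (n - m)%N else [set 0].

Definition grading_parity (V : lmodType F) (gr : nat -> set V) (b : bool) :
    set V :=
  [set v | exists (N : nat) (y : nat -> V),
     (forall n, gr n (y n)) /\ v = \sum_(n < N | odd n == b) y n].

Definition even_parity (V : lmodType F) (b : bool) : set V :=
  if b then [set 0] else setT.

(* The parity of Pi V. *)
Definition flip (V : lmodType F) (p : bool -> set V) (b : bool) : set V :=
  p (~~ b).

Definition has_parity (V : lmodType F) (p : bool -> set V) (a : bool)
    (P : V -> V) : Prop :=
  forall b v, p b v -> p (a (+) b) (P v).

(* The supercommutator of endomorphisms P, Q of parity a, b. *)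
Definition scomm (V : lmodType F) (a b : bool) (P Q : V -> V) : V -> V :=
  fun v => P (Q v) - (-1) ^+ (a && b) *: Q (P v).

Record is_lie_superalgebra (V : lmodType F) (p : bool -> set V)
    (br : V -> V -> V) : Prop := {
  lsa_superspace : is_superspace p;
  lsa_linl v : linear (br^~ v);
  lsa_linr u : linear (br u);
  lsa_par a b u v : p a u -> p b v -> p (a (+) b) (br u v);
  lsa_skew a b u v : p a u -> p b v ->
    br u v = - ((-1) ^+ (a && b) *: br v u);
  lsa_jacobi a b u v w : p a u -> p b v ->
    br u (br v w) = br (br u v) w + (-1) ^+ (a && b) *: br v (br u w)
}.

Record is_complex (W : lmodType F) (q : bool -> set W) (d : W -> W) : Prop := {
  complex_superspace : is_superspace q;
  complex_lin : linear d;
  complex_odd : has_parity q true d;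
  complex_dd w : d (d w) = 0
}.

(* An h-complex, for h = (V, p, br). *)
Record is_lie_complex (V : lmodType F) (p : bool -> set V) (br : V -> V -> V)
    (W : lmodType F) (q : bool -> set W) (d : W -> W) (iota : V -> W -> W) :
    Prop := {
  lcx_complex : is_complex q d;
  lcx_lin w : linear (iota^~ w);
  lcx_end u : linear (iota u);
  lcx_par a u : flip p a u -> has_parity q a (iota u);
  lcx_comm a b u v : flip p a u -> flip p b v ->
    scomm a b (iota u) (iota v) = 0;
  lcx_br a b u v : flip p a u -> flip p b v ->
    scomm (~~ a) b (scomm a true (iota u) d) (iota v) = iota (br u v)
}.

Record is_gerstenhaber (G : lmodType F) (p : bool -> set G)
    (wedge br : G -> G -> G) : Prop := {
  ger_superspace : is_superspace p;
  ger_wedge_linl v : linear (wedge^~ v);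
  ger_wedge_linr u : linear (wedge u);
  ger_wedge_par a b u v : p a u -> p b v -> p (a (+) b) (wedge u v);
  ger_wedgeA u v w : wedge u (wedge v w) = wedge (wedge u v) w;
  ger_wedgeC a b u v : p a u -> p b v ->
    wedge u v = (-1) ^+ (a && b) *: wedge v u;
  ger_lie : is_lie_superalgebra (flip p) br;
  ger_leibniz a b u v w : p a u -> p b v ->
    br u (wedge v w) =
    wedge (br u v) w + (-1) ^+ (~~ a && b) *: wedge v (br u w)
}.

Record is_graded_gerstenhaber (G : lmodType F) (p : bool -> set G)
    (gr : nat -> set G) (wedge br : G -> G -> G) : Prop := {
  gger_gerstenhaber : is_gerstenhaber p wedge br;
  gger_grading : is_grading gr;
  gger_wedge m n u v : gr m u -> gr n v -> gr (m + n)%N (wedge u v);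
  gger_br m n u v : gr m u -> gr n v -> gr_sub gr (m + n) 1 (br u v)
}.

Section Calculus.
Variables (G : lmodType F) (p : bool -> set G) (wedge br : G -> G -> G).
Variables (W : lmodType F) (q : bool -> set W) (d : W -> W).

Record is_calculus (iota L : G -> W -> W) : Prop := {
  cal_complex : is_complex q d;
  cal_iota_lin w : linear (iota^~ w);
  cal_iota_end u : linear (iota u);
  cal_iota_par a u : p a u -> has_parity q a (iota u);
  cal_iota_wedge u v w : iota (wedge u v) w = iota u (iota v w);
  cal_L_lin w : linear (L^~ w);
  cal_L_end u : linear (L u);
  cal_L_par a u : flip p a u -> has_parity q a (L u);
  cal_L_br a b u v : flip p a u -> flip p b v ->
    L (br u v) = scomm a b (L u) (L v);
  cal_L_iota a b u v : flip p a u -> p b v ->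
    scomm a b (L u) (iota v) = iota (br u v);
  cal_L_d a u : p a u -> L u = scomm a true (iota u) d
}.

Record is_graded_calculus (Ggr : nat -> set G) (Wgr : nat -> set W)
    (iota L : G -> W -> W) : Prop := {
  gcal_calculus : is_calculus iota L;
  gcal_grading : is_grading Wgr;
  gcal_d n w : Wgr n w -> Wgr n.+1 (d w);
  gcal_iota m n u w : Ggr m u -> Wgr n w -> gr_sub Wgr n m (iota u w);
  gcal_L m n u w : Ggr m u -> Wgr n w -> gr_sub Wgr n.+1 m (L u w)
}.

End Calculus.
End Super.

Record lieAlgebra (F : fieldType) := LieAlgebra {
  lie_sort :> lmodType F;
  lie : lie_sort -> lie_sort -> lie_sort;
  lie_linl y : linear (lie^~ y);
  lie_linr x : linear (lie x);
  liexx x : lie x x = 0;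
  lie_jacobi x y z : lie x (lie y z) = lie (lie x y) z + lie y (lie x z)
}.

(* A g-module structure on A for which g acts by derivations. *)
Record derAction (F : fieldType) (g : lieAlgebra F) (A : comAlgType F) :=
  DerAction {
  dact :> g -> A -> A;
  dact_linl f : linear (dact^~ f);
  dact_linr x : linear (dact x);
  dact_lie x y f : dact (lie x y) f = dact x (dact y f) - dact y (dact x f);
  dactM x f h : dact x (f * h) = dact x f * h + f * dact x h
}.

(* A Lie superalgebroid (l, A) with l purely even; the F-structure of l comes
   from its A-module structure. *)
Record lieAlgebroid (F : fieldType) (A : comAlgType F) := LieAlgebroid {
  lad_sort :> lmodType A;
  lad_br : res lad_sort -> res lad_sort -> res lad_sort;
  lad_act : lad_sort -> A -> A;
  lad_lie : is_lie_superalgebra (@even_parity F (res lad_sort)) lad_br;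
  lad_actDl X Y h : lad_act (X + Y) h = lad_act X h + lad_act Y h;
  lad_actZl (f : A) X h : lad_act (f *: X) h = f * lad_act X h;
  lad_actr X : linear (lad_act X);
  lad_act_br X Y h :
    lad_act (lad_br X Y) h = lad_act X (lad_act Y h) - lad_act Y (lad_act X h);
  lad_actM X f h : lad_act X (f * h) = lad_act X f * h + f * lad_act X h;
  lad_brZ X (f : A) Y :
    lad_br X (f *: (Y : lad_sort)) =
    lad_act X f *: (Y : lad_sort) + f *: (lad_br X Y : lad_sort)
}.

Section Algebroid.
Variables (F : fieldType) (A : comAlgType F) (l : lieAlgebroid A).

(* The Lie superalgebra l |x Pi A. *)
Definition semi : lmodType F := (res l * A)%type.

Definition semi_parity (b : bool) : set semi :=
  [set u | even_parity b u.1 /\ flip (@even_parity F A) b u.2].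

Definition semi_br (u v : semi) : semi :=
  (lad_br u.1 v.1, lad_act u.1 v.2 - lad_act v.1 u.2).

(* An (l, A)-complex. *)
Record is_algebroid_complex (W : lmodType F) (q : bool -> set W) (d : W -> W)
    (iota : semi -> W -> W) : Prop := {
  acx_lie_complex : is_lie_complex semi_parity semi_br q d iota;
  acx_fg (f h : A) w : iota (0, f * h) w = iota (0, f) (iota (0, h) w);
  acx_fX (f : A) (X : l) w : iota (f *: X, 0) w = iota (0, f) (iota (X, 0) w)
}.

(* The symmetric superalgebra S_A(Pi l), as an F-superspace. *)
Definition schouten_space : lmodType F := res (sym l).

Definition schouten_gr (n : nat) : set schouten_space := @sdeg A l n.

Definition schouten_parity : bool -> set schouten_space :=
  grading_parity schouten_gr.

Definition schouten_wedge (u v : schouten_space) : schouten_space :=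
  (u : sym l) * (v : sym l).

(* The inclusion of Pi l (+) A. *)
Definition schouten_incl (u : semi) : schouten_space :=
  sgen (u.1 : l) + (u.2)%:A.

(* br is the Schouten bracket: the Gerstenhaber bracket on S_A(Pi l) extending
   the bracket of l |x Pi A. *)
Record is_schouten (br : schouten_space -> schouten_space -> schouten_space) :
    Prop := {
  schouten_gerstenhaber : is_graded_gerstenhaber
    schouten_parity schouten_gr schouten_wedge br;
  schouten_extends u v :
    br (schouten_incl u) (schouten_incl v) = schouten_incl (semi_br u v)
}.

End Algebroid.

Section TensorAlgebroid.
Variables (F : fieldType) (g : lieAlgebra F) (A : comAlgType F).
Variable rho : derAction g A.
Implicit Types (f h k : A) (x y z : g) (u v w : tensor A g).

Definition tensor_act u h : A := tlift (fun f x => f * rho x h) u.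

(* [f (x) x, h (x) y] *)
Definition pure_br f x h y : tensor A g :=
  pure (f * h) (lie x y) + pure (f * rho x h) y - pure (h * rho y f) x.

Definition tensor_br u v : tensor A g :=
  tlift (fun f x => tlift (fun h y => pure_br f x h y) v) u.

Fact lieDl x y z : lie (x + y) z = lie x z + lie y z.
Proof. by rewrite -(scale1r x) (@lie_linl _ _ z) !scale1r. Qed.
Fact lieDr x y z : lie x (y + z) = lie x y + lie x z.
Proof. by rewrite -(scale1r y) lie_linr !scale1r. Qed.
Fact lie0l x : lie 0 x = 0 :> g.
Proof. by apply: (addIr (lie 0 x)); rewrite -lieDl !add0r. Qed.
Fact lie0r x : lie x 0 = 0 :> g.
Proof. by apply: (addIr (lie x 0)); rewrite -lieDr !add0r. Qed.
Fact lieZl (c : F) x y : lie (c *: x) y = c *: lie x y.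
Proof. by rewrite -[c *: x]addr0 (@lie_linl _ _ y) lie0l addr0. Qed.
Fact lieZr (c : F) x y : lie x (c *: y) = c *: lie x y.
Proof. by rewrite -[c *: y]addr0 lie_linr lie0r addr0. Qed.
Fact lieC x y : lie x y = - lie y x.
Proof.
apply/eqP; rewrite -addr_eq0; apply/eqP.
by have := liexx (x + y); rewrite lieDl !lieDr !liexx add0r addr0.
Qed.

Fact dactDl x y f : rho (x + y) f = rho x f + rho y f.
Proof. by rewrite -(scale1r x) (@dact_linl _ _ _ rho f) !scale1r. Qed.
Fact dactDr x f h : rho x (f + h) = rho x f + rho x h.
Proof. by rewrite -(scale1r f) dact_linr !scale1r. Qed.
Fact dact0l f : rho 0 f = 0.
Proof. by apply: (addIr (rho 0 f)); rewrite -dactDl !add0r. Qed.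
Fact dact0r x : rho x 0 = 0.
Proof. by apply: (addIr (rho x 0)); rewrite -dactDr !add0r. Qed.
Fact dactZl (c : F) x f : rho (c *: x) f = c *: rho x f.
Proof. by rewrite -[c *: x]addr0 (@dact_linl _ _ _ rho f) dact0l addr0. Qed.
Fact dactZr (c : F) x f : rho x (c *: f) = c *: rho x f.
Proof. by rewrite -[c *: f]addr0 dact_linr dact0r addr0. Qed.

Fact tensor_act_balanced h : balanced (fun f x => f * rho x h).
Proof.
split=> [a a' x|a x x'|c a x]; first by rewrite mulrDl.
  by rewrite dactDl mulrDr.
by rewrite dactZl -scalerAl -scalerAr.
Qed.
Lemma tensor_act_pure f x h : tensor_act (pure f x) h = f * rho x h.
Proof. exact: (tlift_pure (tensor_act_balanced h)). Qed.
Lemma tensor_actDl u v h : tensor_act (u + v) h = tensor_act u h + tensor_act v h.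
Proof. exact: (tliftD (tensor_act_balanced h)). Qed.
Lemma tensor_act0l h : tensor_act 0 h = 0.
Proof. exact: (tlift0 (tensor_act_balanced h)). Qed.

Fact pure_br_balanced f x : balanced (pure_br f x).
Proof.
split=> [a a' y|a y y'|c a y]; rewrite /pure_br.
- by rewrite dactDr !mulrDr mulrDl !pureDl opprD [RHS]addrACA [in RHS](addrACA (pure _ _)).
- by rewrite lieDr dactDl mulrDr !pureDr pureDl opprD [RHS]addrACA [in RHS](addrACA (pure _ _)).
- by rewrite lieZr dactZr dactZl -!scalerAr -scalerAl !pureZ.
Qed.
Fact tensor_br_balanced v :
  balanced (fun f x => tlift (fun h y => pure_br f x h y) v).
Proof.
have bP f x := pure_br_balanced f x.
split=> [a a' x|a x x'|c a x]; elim/tensor_ind: v => [|b y|v w IHv IHw];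
  rewrite ?(tlift0 (bP _ _)) ?(tlift_pure (bP _ _)) ?(tliftD (bP _ _))
    ?addr0 // /pure_br.
- by rewrite dactDr !mulrDl mulrDr !pureDl opprD [RHS]addrACA [in RHS](addrACA (pure _ _)).
- by rewrite IHv IHw addrACA.
- by rewrite lieDl dactDl mulrDr !pureDr pureDl opprD [RHS]addrACA [in RHS](addrACA (pure _ _)).
- by rewrite IHv IHw addrACA.
- by rewrite lieZl dactZr dactZl -!scalerAr -!scalerAl !pureZ.
- by rewrite IHv IHw.
Qed.
Lemma tensor_br_pure f x h y :
  tensor_br (pure f x) (pure h y) = pure_br f x h y.
Proof.
by rewrite /tensor_br (tlift_pure (tensor_br_balanced _))
  (tlift_pure (pure_br_balanced _ _)).
Qed.
Lemma tensor_brDl u v w : tensor_br (u + v) w = tensor_br u w + tensor_br v w.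
Proof. exact: (tliftD (tensor_br_balanced w)). Qed.
Lemma tensor_br0l u : tensor_br 0 u = 0.
Proof. exact: (tlift0 (tensor_br_balanced u)). Qed.
Lemma tensor_br0r u : tensor_br u 0 = 0.
Proof.
elim/tensor_ind: u => [|f x|u v IHu IHv]; first exact: tensor_br0l.
  by rewrite /tensor_br (tlift_pure (tensor_br_balanced _))
    (tlift0 (pure_br_balanced _ _)).
by rewrite tensor_brDl IHu IHv addr0.
Qed.
Lemma tensor_brDr u v w : tensor_br u (v + w) = tensor_br u v + tensor_br u w.
Proof.
elim/tensor_ind: u => [|f x|u u' IHu IHu']; first by rewrite !tensor_br0l addr0.
  by rewrite /tensor_br !(tlift_pure (tensor_br_balanced _))
    (tliftD (pure_br_balanced _ _)).
by rewrite !tensor_brDl IHu IHu' addrACA.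
Qed.

Fact tensor_brC u v : tensor_br u v = - tensor_br v u.
Proof.
elim/tensor_ind: u => [|f x|u u' IHu IHu'];
  rewrite ?tensor_br0l ?tensor_br0r ?oppr0 //; last first.
  by rewrite tensor_brDl tensor_brDr IHu IHu' opprD.
elim/tensor_ind: v => [|h y|v v' IHv IHv'];
  rewrite ?tensor_br0l ?tensor_br0r ?oppr0 //; last first.
  by rewrite tensor_brDl tensor_brDr IHv IHv' opprD.
rewrite !tensor_br_pure /pure_br lieC [h * f]mulrC.
have pureN k z : pure k (- z) = - pure k z :> tensor A g.
  by rewrite -scaleN1r -pureZ scaleN1r -[- k]mulN1r -scale_pure scaleN1r.
by rewrite pureN !opprD opprK -!addrA; congr (_ + _); rewrite addrC.
Qed.

Fact pureBl f h x : pure (f - h) x = pure f x - pure h x :> tensor A g.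
Proof. by rewrite pureDl -[- h]mulN1r -scale_pure scaleN1r. Qed.

Fact tensor_actr u : linear (tensor_act u).
Proof.
move=> c h k; elim/tensor_ind: u => [|f x|u v IHu IHv].
- by rewrite !tensor_act0l scaler0 addr0.
- by rewrite !tensor_act_pure dact_linr mulrDr -scalerAr.
- by rewrite !tensor_actDl IHu IHv scalerDr addrACA.
Qed.
Fact tensor_actB u h k : tensor_act u (h - k) = tensor_act u h - tensor_act u k.
Proof. by rewrite addrC -scaleN1r tensor_actr scaleN1r addrC. Qed.
Fact tensor_actD u h k : tensor_act u (h + k) = tensor_act u h + tensor_act u k.
Proof. by rewrite -[h]scale1r tensor_actr !scale1r. Qed.
Fact tensor_act0r u : tensor_act u 0 = 0.
Proof. by apply: (addIr (tensor_act u 0)); rewrite -tensor_actD !add0r. Qed.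
Fact tensor_actM u h k :
  tensor_act u (h * k) = tensor_act u h * k + h * tensor_act u k.
Proof.
elim/tensor_ind: u => [|f x|u v IHu IHv].
- by rewrite !tensor_act0l mul0r mulr0 addr0.
- by rewrite !tensor_act_pure dactM; ring.
- by rewrite !tensor_actDl IHu IHv; ring.
Qed.
Fact tensor_actZ f u h : tensor_act (f *: u) h = f * tensor_act u h.
Proof.
elim/tensor_ind: u => [|k x|u v IHu IHv].
- by rewrite scaler0 !tensor_act0l mulr0.
- by rewrite scale_pure !tensor_act_pure mulrA.
- by rewrite scalerDr !tensor_actDl IHu IHv mulrDr.
Qed.
Fact tensor_act_br u v h : tensor_act (tensor_br u v) h =
  tensor_act u (tensor_act v h) - tensor_act v (tensor_act u h).
Proof.
have actN w k : tensor_act (- w) k = - tensor_act w k.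
  by rewrite -scaleN1r tensor_actZ mulN1r.
elim/tensor_ind: u => [|f x|u u' IHu IHu']; last first.
- by rewrite tensor_brDl !tensor_actDl tensor_actD IHu IHu'; ring.
- elim/tensor_ind: v => [|k y|v v' IHv IHv']; last first.
  + by rewrite tensor_brDr !tensor_actDl tensor_actD IHv IHv'; ring.
  + rewrite tensor_br_pure /pure_br !tensor_actDl actN !tensor_act_pure.
    by rewrite dact_lie !dactM; ring.
  + by rewrite tensor_br0r !tensor_act0l tensor_act0r subr0.
- by rewrite tensor_br0l !tensor_act0l tensor_act0r subr0.
Qed.
Fact tensor_brZ u f v :
  tensor_br u (f *: v) = tensor_act u f *: v + f *: tensor_br u v.
Proof.
elim/tensor_ind: u => [|k x|u u' IHu IHu']; last first.
- by rewrite !tensor_brDl tensor_actDl IHu IHu' scalerDr scalerDl addrACA.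
- elim/tensor_ind: v => [|h y|v v' IHv IHv']; last first.
  + by rewrite scalerDr !tensor_brDr IHv IHv' !scalerDr addrACA.
  + rewrite scale_pure !tensor_br_pure tensor_act_pure /pure_br.
    rewrite !scalerDr scalerN !scale_pure dactM.
    rewrite mulrDr pureDl !addrA (addrC (pure (k * rho x f * h) y)).
    by congr (pure _ _ + pure _ _ + pure _ _ - pure _ _); ring.
  + by rewrite !scaler0 tensor_br0r scaler0 addr0.
- by rewrite !tensor_br0l tensor_act0l scale0r scaler0 addr0.
Qed.

Fact tensor_act_cst u (c : F) : tensor_act u c%:A = 0.
Proof.
have act1 : tensor_act u 1 = 0.
  by apply: (addIr (tensor_act u 1)); rewrite add0r -{3}[1]mulr1
     tensor_actM mulr1 mul1r.
by rewrite -[c%:A]addr0 tensor_actr act1 tensor_act0r scaler0 addr0.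
Qed.

Let jac u v w := tensor_br u (tensor_br v w) =
  tensor_br (tensor_br u v) w + tensor_br v (tensor_br u w).

Let tensor_brNl u v : tensor_br (- u) v = - tensor_br u v.
Proof. by apply/eqP; rewrite -addr_eq0 -tensor_brDl addNr tensor_br0l. Qed.
Let tensor_brNr u v : tensor_br u (- v) = - tensor_br u v.
Proof. by apply/eqP; rewrite -addr_eq0 -tensor_brDr addNr tensor_br0r. Qed.

Let jac12 u v w : jac u v w -> jac v u w.
Proof.
by rewrite /jac (tensor_brC v u) tensor_brNl => ->; rewrite addrA addNr add0r.
Qed.
Let jac23 u v w : jac u v w -> jac u w v.
Proof.
rewrite /jac (tensor_brC w v) tensor_brNr => ->; rewrite opprD addrC.
by rewrite -(tensor_brC (tensor_br u w)) -(tensor_brC w).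
Qed.
Let jac_gen u v : (forall z, jac u v (pure 1 z)) -> forall w, jac u v w.
Proof.
move=> h; elim/tensor_ind => [|f z|w w' IHw IHw']; rewrite /jac.
- by rewrite !tensor_br0r addr0.
- rewrite -[f]mulr1 -scale_pure; move: (pure 1 z) (h z) => w hw.
  rewrite !tensor_brZ !tensor_brDr !tensor_brZ hw tensor_act_br.
  rewrite scalerDr scalerBl.
  by rewrite [RHS](AC (3*(2*2)) ((2*4)*((1*6)*(5*(3*7))))) /= addNr add0r.
- by rewrite !tensor_brDr IHw IHw' addrACA.
Qed.

Fact tensor_jacobi u v w : tensor_br u (tensor_br v w) =
  tensor_br (tensor_br u v) w + tensor_br v (tensor_br u w).
Proof.
have pure1 x y : tensor_br (pure 1 x) (pure 1 y) = pure 1 (lie x y).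
  have d1 z : rho z 1 = 0.
    by have := tensor_act_cst (pure 1 z) 1; rewrite scale1r tensor_act_pure mul1r.
  by rewrite tensor_br_pure /pure_br !d1 !mulr0 mulr1 !pure0 subr0 addr0.
change (jac u v w).
apply: jac_gen w => z; apply/jac12/jac23.
apply: jac_gen u => x; apply/jac12/jac23.
apply: jac_gen v => y.
by rewrite /jac !pure1 lie_jacobi pureDr.
Qed.

Fact tensor_lie : is_lie_superalgebra (@even_parity F (res (tensor A g)))
  (tensor_br : res (tensor A g) -> res (tensor A g) -> res (tensor A g)).
Proof.
have linr u : linear (tensor_br u : res (tensor A g) -> res (tensor A g)).
  move=> c v w; rewrite tensor_brDr tensor_brZ tensor_act_cst scale0r add0r.
  by [].
split=> //.
- split.
  + by case; split=> //= c u v -> ->; rewrite scaler0 addr0.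
  + by move=> v; exists v, 0; split; rewrite ?addr0.
  + by move=> v _.
- by move=> v c u w; rewrite tensor_brC linr opprD -scalerN -!tensor_brC.
- by case=> [] [] u v //= => [-> _|_ ->];
    rewrite ?tensor_br0l ?tensor_br0r.
- case=> [] [] u v /= => [-> ->|-> _|_ ->|_ _];
    rewrite ?tensor_br0l ?tensor_br0r ?scaler0 ?oppr0 //.
  by rewrite expr0 scale1r tensor_brC.
- case=> [] [] u v w /= => [-> ->|-> _|_ ->|_ _];
    rewrite ?tensor_br0l ?tensor_br0r ?tensor_br0l ?scaler0 ?addr0 //.
  by rewrite expr0 scale1r tensor_jacobi.
Qed.

Definition tensor_algebroid : lieAlgebroid A := @LieAlgebroid F A (tensor A g)
  tensor_br tensor_act tensor_lie tensor_actDl (fun f u h => tensor_actZ f u h)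
  tensor_actr tensor_act_br tensor_actM tensor_brZ.

End TensorAlgebroid.

Section Cochains.
Variables (F : fieldType) (V : lmodType F) (A : comAlgType F).

(* As F has characteristic 0, [sym V] (over F) is the exterior algebra of V.
   An element of the direct sum of the Hom(wedge^k V, A) is encoded as a linear
   map on the whole exterior algebra vanishing in all large degrees; k-cochains
   vanish in all degrees but k. *)
Definition is_cochain (w : sym V -> A) : Prop :=
  linear w /\ exists N : nat, forall n, (N <= n)%N ->
    forall Y, sdeg n Y -> w Y = 0.

Definition cochain_pred (w : sym V -> A) : bool := `[< is_cochain w >].

Record cochain := Cochain {
  cochain_fun :> sym V -> A;
  cochainP : cochain_pred cochain_fun
}.

HB.instance Definition _ := [isSub for cochain_fun].
HB.instance Definition _ := [Choice of cochain by <:].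

Fact cochain_submod : subsemimod_closed cochain_pred.
Proof.
split; first split.
- by apply/asboolP; split=> [c x y|]; [rewrite /= scaler0 addr0|exists 0%N].
- move=> w w' /asboolP[wl [N wN]] /asboolP[w'l [N' w'N]]; apply/asboolP; split.
    by move=> c x y; rewrite !fctE wl w'l scalerDr addrACA.
  exists (maxn N N') => n; rewrite geq_max => /andP[hN hN'] Y hY.
  by rewrite !fctE (wN n) // (w'N n) // addr0.
- move=> c w /asboolP[wl [N wN]]; apply/asboolP; split.
    by move=> k x y; rewrite !fctE wl scalerDr !scalerA mulrC.
  by exists N => n hn Y hY; rewrite !fctE (wN n) // scaler0.
Qed.

HB.instance Definition _ := GRing.isSubmodClosed.Build F (sym V -> A)
  cochain_pred cochain_submod.
HB.instance Definition _ := [SubChoice_isSubLmodule of cochain by <:].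

Lemma cochain_linear (w : cochain) : linear w.
Proof. by have /asboolP[] := cochainP w. Qed.
Lemma cochainE (w w' : cochain) : w =1 w' -> w = w'.
Proof. by move=> h; apply/val_inj/funext. Qed.

Definition cochain_gr (k : nat) : set cochain :=
  [set w | forall n, n != k -> forall Y, sdeg n Y -> w Y = 0].

Definition cochain_parity : bool -> set cochain := grading_parity cochain_gr.

Lemma sdegM_gen (x : V) n (Y : sym V) : sdeg n Y -> sdeg n.+1 (sgen x * Y).
Proof.
move=> [m [r [y ->]]]; exists m, r.
exists (fun i j => if unlift ord0 j is Some k then y i k else x).
rewrite mulr_sumr; apply: eq_bigr => i _; rewrite -scalerAr big_ord_recl.
rewrite unlift_none; congr (_ *: (_ * _)); apply: eq_bigr => j _.
by rewrite liftK.
Qed.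

Fact cochain_mul_subproof (f : A) (w : cochain) :
  cochain_pred (fun Y => f * w Y).
Proof.
have /asboolP[wl [N wN]] := cochainP w; apply/asboolP; split.
  by move=> c x y; rewrite wl mulrDr scalerAr.
by exists N => n hn Y hY; rewrite (wN n) // mulr0.
Qed.
Definition cochain_mul f w := Cochain (cochain_mul_subproof f w).

Fact cochain_contr_subproof (x : V) (w : cochain) :
  cochain_pred (fun Y => w (sgen x * Y)).
Proof.
have /asboolP[wl [N wN]] := cochainP w; apply/asboolP; split.
  by move=> c y z; rewrite mulrDr -scalerAr wl.
exists N => n hn Y hY; apply: (wN n.+1); first exact: leqW.
exact: sdegM_gen.
Qed.
Definition cochain_contr x w := Cochain (cochain_contr_subproof x w).

(* iota_(f (x) X) = iota_f iota_X *)
Definition cochain_iota (u : res (tensor A V) * A) (w : cochain) : cochain :=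
  tlift (fun f x => cochain_mul f (cochain_contr x w)) (u.1 : tensor A V)
  + cochain_mul u.2 w.

Lemma cochain_iota_pure (f h : A) (x : V) (w : cochain) :
  cochain_iota (pure f x, h) w =
  cochain_mul f (cochain_contr x w) + cochain_mul h w.
Proof.
rewrite /cochain_iota /= tlift_pure //; split=> [a a' y|a y y'|c a y];
  apply: cochainE => Y /=.
- by rewrite mulrDl.
- have := sgenP 1 y y'; rewrite !scale1r => ->.
  have := cochain_linear w 1 (sgen y * Y) (sgen y' * Y).
  by rewrite !scale1r mulrDl => ->; rewrite mulrDr.
- have sgenZ : sgen (c *: y) = c *: sgen y :> sym V.
    have sgen0 : sgen 0 = 0 :> sym V.
      have := sgenP 1 (0 : V) 0; rewrite !scale1r addr0 => e.
      by apply: (addIr (sgen 0)); rewrite -e add0r.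
    by rewrite -[c *: y]addr0 sgenP sgen0 addr0.
  have w0 : w 0 = 0.
    have := cochain_linear w 1 0 0; rewrite !scale1r addr0 => e.
    by apply: (addIr (w 0)); rewrite -e add0r.
  rewrite sgenZ -scalerAl -scalerAl; have := cochain_linear w c (sgen y * Y) 0.
  by rewrite addr0 w0 addr0 => ->; rewrite scalerAr.
Qed.

(* Linear maps on the exterior algebra from alternating families of multilinear
   maps. *)

Record alternating (m : seq V -> A) : Prop := {
  alt_lin s1 s2 (c : F) x y :
    m (s1 ++ (c *: x + y) :: s2) = c *: m (s1 ++ x :: s2) + m (s1 ++ y :: s2);
  alt_swap s1 s2 x y : m (s1 ++ x :: y :: s2) = - m (s1 ++ y :: x :: s2)
}.

Fixpoint tact (t : sterm V) (m : seq V -> A) : seq V -> A :=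
  match t with
  | SCst r => r *: m
  | SGen x => fun s => m (x :: s)
  | SAdd t u => tact t m + tact u m
  | SMul t u => tact u (tact t m)
  end.

Let tact_alt t m : alternating m -> alternating (tact t m).
Proof.
elim: t m => [r|x|t IHt u IHu|t IHt u IHu] m hm /=.
- split=> [s1 s2 c x y|s1 s2 x y]; rewrite !fctE.
    by rewrite (alt_lin hm) scalerDr !scalerA mulrC.
  by rewrite (alt_swap hm) scalerN.
- split=> [s1 s2 c y z|s1 s2 y z].
    exact: (alt_lin hm (x :: s1)).
  exact: (alt_swap hm (x :: s1)).
- have [hl hs] := IHt _ hm; have [hl' hs'] := IHu _ hm.
  split=> [s1 s2 c y z|s1 s2 y z]; rewrite !fctE.
    by rewrite hl hl' scalerDr addrACA.
  by rewrite hs hs' opprD.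
- exact/IHu/IHt.
Qed.

Let tact_lin t (c : F) m m' : tact t (c *: m + m') = c *: tact t m + tact t m'.
Proof.
elim: t m m' => [r|x|t IHt u IHu|t IHt u IHu] m m' /=.
- by rewrite scalerDr !scalerA mulrC.
- by [].
- by rewrite IHt IHu scalerDr addrACA.
- by rewrite IHt IHu.
Qed.

Let tact0 t : tact t 0 = 0.
Proof.
have := tact_lin t 1 0 0; rewrite !scale1r addr0 => h.
by apply: (addIr (tact t 0)); rewrite -h add0r.
Qed.
Let tactD t m m' : tact t (m + m') = tact t m + tact t m'.
Proof. by have := tact_lin t 1 m m'; rewrite !scale1r. Qed.
Let tactZ t c m : tact t (c *: m) = c *: tact t m.
Proof. by rewrite -[c *: m]addr0 tact_lin tact0 addr0. Qed.

Let tact_cong t u m : alternating m -> scong t u -> tact t m = tact u m.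
Proof.
move=> hm tu; elim: tu m hm => {t u} /=.
- by [].
- by move=> t u _ IH m hm; rewrite IH.
- by move=> t u v _ IH _ IH' m hm; rewrite IH // IH'.
- by move=> t t' u u' _ IH _ IH' m hm; rewrite IH // IH'.
- by move=> t t' u u' _ IH _ IH' m hm; rewrite IH // IH' //; apply: tact_alt.
- by move=> *; rewrite addrA.
- by move=> *; rewrite addrC.
- by move=> *; rewrite scale0r add0r.
- by [].
- by move=> t m _; rewrite !scale0r tact0.
- by move=> t m _; rewrite scale1r.
- by move=> t u v m _; rewrite tactD.
- by [].
- by move=> r s m _; rewrite scalerDl.
- by move=> r s m _; rewrite scalerA mulrC.
- by move=> r t m _; rewrite tactZ.
- move=> x y m hm; apply/funext => s; rewrite !fctE.
  by have := alt_lin hm [::] s 1 x y; rewrite !scale1r.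
- move=> r x m hm; apply/funext => s; rewrite !fctE.
  have m0 : m (0 :: s) = 0.
    have := alt_lin hm [::] s 1 0 0; rewrite !scale1r addr0 /= => e.
    by apply: (addIr (m (0 :: s))); rewrite -e add0r.
  by have := alt_lin hm [::] s r x 0; rewrite addr0 /= m0 addr0.
- move=> x y m hm; apply/funext => s; rewrite !fctE.
  by rewrite [m [:: x, y & s]](alt_swap hm [::]) addrC subrr scale0r.
Qed.

Lemma alt_lift (m : seq V -> A) : alternating m ->
  exists phi : sym V -> A, linear phi /\ forall s, phi (\prod_(x <- s) sgen x) = m s.
Proof.
move=> hm; pose phi (Y : sym V) := tact (srepr Y) m [::].
have phiE t : phi (spi t) = tact t m [::].
  by rewrite /phi (tact_cong hm (srepr_pi t)).
exists phi; split.
  move=> c x y; rewrite -(sreprK x) -(sreprK y).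
  have -> : c *: spi (srepr x) = spi (SMul (SCst V c) (srepr x)).
    by rewrite spiM spiC -scalerAl mul1r.
  by rewrite -spiD !phiE /= tactZ.
move=> s.
have [t [<- tE]] : exists t, spi t = \prod_(x <- s) sgen x /\
    forall m' r, tact t m' r = m' (s ++ r).
  elim: s => [|x s [t [tE tact_t]]].
    by exists (SCst V 1); rewrite big_nil spiC scale1r; split=> // m' r /=;
       rewrite scale1r.
  exists (SMul (SGen x) t); rewrite big_cons spiM tE; split=> // m' r /=.
  by rewrite tact_t.
by rewrite phiE tE cats0.
Qed.

End Cochains.

Section Differential.
Variables (F : fieldType) (g : lieAlgebra F) (A : comAlgType F).
Variable rho : derAction g A.
Implicit Types (x y z : g) (w : sym g -> A) (s : seq g).

(* Indices start at 0, which does not affect the signs: (-1)^(i+1) becomes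
   (-1)^i and (-1)^(i+j) is unchanged. *)
Definition ce_formula (n : nat) (X : 'I_n -> g) w : A :=
  \sum_(i < n) (-1) ^+ i * rho (X i) (w (\prod_(k < n | k != i) sgen (X k)))
  + \sum_(i < n) \sum_(j < n | (i < j)%N) (-1) ^+ (i + j) *
      w (sgen (lie (X i) (X j)) *
         \prod_(k < n | (k != i) && (k != j)) sgen (X k)).

Definition is_ce_diff (w eta : cochain g A) : Prop :=
  forall n (X : 'I_n -> g), eta (\prod_(i < n) sgen (X i)) = ce_formula X w.

(* ce_fam is a recursive form of ce_formula: the alternating family
   iota_x d = L_x - d iota_x. *)

Let contr x w : sym g -> A := fun Y => w (sgen x * Y).
Let mon s : sym g := \prod_(x <- s) sgen x.

Fixpoint ce_br (x : g) s w : A :=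
  if s is y :: s' then w (sgen (lie x y) * mon s') + ce_br x s' (contr y w)
  else 0.

Fixpoint ce_fam s w : A :=
  if s is x :: s' then
    rho x (w (mon s')) - ce_br x s' w - ce_fam s' (contr x w)
  else 0.

Let contr_lin x w : linear w -> linear (contr x w).
Proof. by move=> wl c Y Z; rewrite /contr mulrDr -scalerAr wl. Qed.

Let linD w : linear w -> forall Y Z, w (Y + Z) = w Y + w Z.
Proof. by move=> wl Y Z; have := wl 1 Y Z; rewrite !scale1r. Qed.
Let lin0 w : linear w -> w 0 = 0.
Proof.
move=> wl; have := linD wl 0 0; rewrite addr0 => e.
by apply: (addIr (w 0)); rewrite -e add0r.
Qed.
Let linN w : linear w -> forall Y, w (- Y) = - w Y.
Proof.
by move=> wl Y; apply/eqP; rewrite -addr_eq0 -linD // addNr lin0.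
Qed.
Let linZ w : linear w -> forall (c : F) Y, w (c *: Y) = c *: w Y.
Proof. by move=> wl c Y; rewrite -[c *: Y]addr0 wl lin0 // addr0. Qed.

Let contr_comb (c : F) x y w : linear w ->
  contr (c *: x + y) w = c *: contr x w + contr y w.
Proof.
move=> wl; apply/funext => Y.
by rewrite !fctE /contr sgenP mulrDl -scalerAl wl.
Qed.
Let contr_anti x y w : linear w -> contr x (contr y w) = - contr y (contr x w).
Proof.
move=> wl; apply/funext => Y; rewrite !fctE /contr !mulrA sgen_anti mulNr.
by rewrite linN.
Qed.
Let contr_linw (c : F) x w w' : contr x (c *: w + w') = c *: contr x w + contr x w'.
Proof. by []. Qed.

Let comb3 (c : F) (a a' b b' e e' : A) :
  c *: a + a' - (c *: b + b') - (c *: e + e') =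
  c *: (a - b - e) + (a' - b' - e').
Proof. by rewrite !scalerBr; ring. Qed.

Let ce_br_linw (c : F) x s w w' :
  ce_br x s (c *: w + w') = c *: ce_br x s w + ce_br x s w'.
Proof.
elim: s w w' => [|y s IH] w w' /=; first by rewrite scaler0 addr0.
by rewrite contr_linw IH !fctE !scalerDr addrACA.
Qed.
Let ce_fam_linw (c : F) s w w' :
  ce_fam s (c *: w + w') = c *: ce_fam s w + ce_fam s w'.
Proof.
elim: s w w' => [|y s IH] w w' /=; first by rewrite scaler0 addr0.
rewrite contr_linw IH ce_br_linw !fctE dact_linr.
exact: comb3.
Qed.
Let ce_fam0 s : ce_fam s 0 = 0.
Proof.
have := ce_fam_linw 1 s 0 0; rewrite !scale1r addr0 => e.
by apply: (addIr (ce_fam s 0)); rewrite -e add0r.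
Qed.
Let ce_br0 x s : ce_br x s 0 = 0.
Proof.
have := ce_br_linw 1 x s 0 0; rewrite !scale1r addr0 => e.
by apply: (addIr (ce_br x s 0)); rewrite -e add0r.
Qed.
Let ce_famN s w : ce_fam s (- w) = - ce_fam s w.
Proof. by rewrite -[- w]addr0 -scaleN1r ce_fam_linw ce_fam0 addr0 scaleN1r. Qed.
Let ce_brN x s w : ce_br x s (- w) = - ce_br x s w.
Proof. by rewrite -[- w]addr0 -scaleN1r ce_br_linw ce_br0 addr0 scaleN1r. Qed.

Let mon_lin s1 s2 (c : F) x y :
  mon (s1 ++ (c *: x + y) :: s2) = c *: mon (s1 ++ x :: s2) + mon (s1 ++ y :: s2).
Proof.
rewrite /mon !big_cat !big_cons /= sgenP mulrDl mulrDr.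
by rewrite -scalerAl -scalerAr.
Qed.
Let mon_swap s1 s2 x y : mon (s1 ++ x :: y :: s2) = - mon (s1 ++ y :: x :: s2).
Proof.
rewrite /mon !big_cat !big_cons /=.
by rewrite (mulrA (sgen x)) (mulrA (sgen y)) sgen_anti mulNr mulrN.
Qed.

Let ce_br_linx (c : F) x y s w : linear w ->
  ce_br (c *: x + y) s w = c *: ce_br x s w + ce_br y s w.
Proof.
elim: s w => [|z s IH] w wl /=; first by rewrite scaler0 addr0.
rewrite lieDl lieZl sgenP mulrDl -scalerAl wl (IH _ (contr_lin _ wl)).
by rewrite scalerDr addrACA.
Qed.
Let ce_br_lin z s1 s2 (c : F) x y w : linear w ->
  ce_br z (s1 ++ (c *: x + y) :: s2) w =
  c *: ce_br z (s1 ++ x :: s2) w + ce_br z (s1 ++ y :: s2) w.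
Proof.
elim: s1 w => [|u s1 IH] w wl /=.
  rewrite contr_comb // ce_br_linw lieDr lieZr sgenP mulrDl -scalerAl wl.
  by rewrite scalerDr addrACA.
rewrite (IH _ (contr_lin _ wl)) mon_lin mulrDr -scalerAr wl.
by rewrite scalerDr addrACA.
Qed.
Let ce_br_swap z s1 s2 x y w : linear w ->
  ce_br z (s1 ++ x :: y :: s2) w = - ce_br z (s1 ++ y :: x :: s2) w.
Proof.
elim: s1 w => [|u s1 IH] w wl /=.
  rewrite (contr_anti y) // ce_brN /mon !big_cons /contr !mulrA.
  by rewrite (sgen_anti x) (sgen_anti y) !mulNr !linN //; ring.
by rewrite (IH _ (contr_lin _ wl)) mon_swap mulrN linN // opprD.
Qed.

Let ce_fam_lin s1 s2 (c : F) x y w : linear w ->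
  ce_fam (s1 ++ (c *: x + y) :: s2) w =
  c *: ce_fam (s1 ++ x :: s2) w + ce_fam (s1 ++ y :: s2) w.
Proof.
elim: s1 w => [|u s1 IH] w wl /=.
  rewrite contr_comb // ce_fam_linw ce_br_linx // (@dact_linl _ _ _ rho).
  exact: comb3.
rewrite (IH _ (contr_lin _ wl)) ce_br_lin // mon_lin wl dact_linr.
exact: comb3.
Qed.
Let dactN x f : rho x (- f) = - rho x f.
Proof. by apply/eqP; rewrite -addr_eq0 -dactDr addNr dact0r. Qed.
Let ce_fam_swap s1 s2 x y w : linear w ->
  ce_fam (s1 ++ x :: y :: s2) w = - ce_fam (s1 ++ y :: x :: s2) w.
Proof.
elim: s1 w => [|u s1 IH] w wl /=; last first.
  by rewrite (IH _ (contr_lin _ wl)) ce_br_swap // mon_swap linN // dactN !opprD.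
rewrite (contr_anti y) // ce_famN /mon !big_cons (lieC x y).
rewrite -[sgen (- _)]addr0 -scaleN1r.
have -> : sgen (-1 *: lie y x) = - sgen (lie y x) :> sym g.
  have g0 : sgen 0 = 0 :> sym g.
    have := sgenP 1 (0 : g) 0; rewrite !scale1r addr0 => e.
    by apply: (addIr (sgen 0)); rewrite -e add0r.
  by rewrite -[-1 *: _]addr0 sgenP g0 addr0 scaleN1r.
rewrite addr0 mulNr linN // /contr.
ring.
Qed.

Let ce_br_vanish x s w :
  (forall t, (size s <= size t)%N -> w (mon t) = 0) -> ce_br x s w = 0.
Proof.
elim: s w => [|y s IH] w h //=; rewrite IH.
  have := h (lie x y :: s) (leqnn _).
  by rewrite /mon big_cons addr0.
by move=> t ht; have := h (y :: t) ht; rewrite /mon big_cons.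
Qed.
Let ce_fam_vanish s w :
  (forall t, (size s <= (size t).+1)%N -> w (mon t) = 0) -> ce_fam s w = 0.
Proof.
elim: s w => [|x s IH] w h //=; rewrite h // dact0r ce_br_vanish // IH ?subr0 //.
by move=> t ht; have := h (x :: t) ht; rewrite /mon big_cons.
Qed.

Let prodS (n : nat) (P : pred 'I_n.+1) (f : 'I_n.+1 -> sym g) :
  \prod_(k < n.+1 | P k) f k =
  (if P ord0 then f ord0 else 1) *
  \prod_(k < n | P (lift ord0 k)) f (lift ord0 k).
Proof. by rewrite big_mkcond big_ord_recl -big_mkcond. Qed.
Let sumS (n : nat) (P : pred 'I_n.+1) (f : 'I_n.+1 -> A) :
  \sum_(k < n.+1 | P k) f k =
  (if P ord0 then f ord0 else 0) +
  \sum_(k < n | P (lift ord0 k)) f (lift ord0 k).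
Proof. by rewrite big_mkcond big_ord_recl -big_mkcond. Qed.
Let mon_enum n (X : 'I_n -> g) :
  mon (map X (enum 'I_n)) = \prod_(k < n) sgen (X k).
Proof. by rewrite /mon big_map enumT; congr bigop; rewrite /index_enum; case: index_enum_key. Qed.
Let map_enumS n (X : 'I_n.+1 -> g) :
  map X (enum 'I_n.+1) = X ord0 :: map (fun k => X (lift ord0 k)) (enum 'I_n).
Proof. by rewrite enum_ordSl /= -map_comp. Qed.
Let liftE n (i j : 'I_n) : (lift ord0 i != lift ord0 j) = (i != j).
Proof. by rewrite (inj_eq lift_inj). Qed.

Let ce_brE n (X : 'I_n -> g) x w : linear w ->
  ce_br x (map X (enum 'I_n)) w =
  \sum_(j < n) (-1) ^+ j *
     w (sgen (lie x (X j)) * \prod_(k < n | k != j) sgen (X k)).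
Proof.
elim: n X w => [|n IH] X w wl.
  by rewrite big_ord0 enum_ord0.
rewrite map_enumS /= (IH _ _ (contr_lin _ wl)) big_ord_recl mon_enum expr0 mul1r.
congr (_ + _).
  by rewrite prodS eqxx mul1r; congr (w (_ * _)); apply: eq_bigl => k.
apply: eq_bigr => j _; rewrite prodS /= /contr.
under [in RHS]eq_bigl do rewrite liftE.
by rewrite exprS mulN1r !mulrA (sgen_anti (X ord0)) !mulNr linN // mulrN.
Qed.

Let ce_famE n (X : 'I_n -> g) w : linear w ->
  ce_fam (map X (enum 'I_n)) w = ce_formula X w.
Proof.
elim: n X w => [|n IH] X w wl.
  by rewrite /ce_formula !big_ord0 addr0 enum_ord0.
rewrite map_enumS /= (IH _ _ (contr_lin _ wl)) ce_brE // mon_enum /ce_formula.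
rewrite !big_ord_recl /= expr0 mul1r opprD !addrA; congr (_ + _).
  rewrite -addrA [RHS]addrAC -!addrA; congr (_ + _).
    rewrite prodS eqxx mul1r; congr (rho _ (w _)); exact: eq_bigl.
  rewrite sumS /= add0r -!sumrN; congr (_ + _); apply: eq_bigr => i _.
    rewrite prodS /= mul1r exprS mulN1r mulNr; congr (- (_ * w (_ * _))).
  rewrite prodS /= exprS mulN1r mulNr; congr (- (_ * rho _ (w (_ * _)))).
rewrite -sumrN; apply: eq_bigr => i _; rewrite sumS /= add0r -sumrN.
apply: eq_big => [j|j _]; first by [].
rewrite prodS /= /contr !mulrA (sgen_anti (X ord0)) mulNr linN // mulrN opprK.
rewrite /bump /= !add1n addSn addnS !exprS !mulN1r opprK.
by congr (_ * w (_ * _)); apply: eq_bigl.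
Qed.

Lemma ce_diff_exists (w : cochain g A) :
  exists eta : cochain g A, is_ce_diff w eta.
Proof.
have wl := cochain_linear w; have /asboolP[_ [N wN]] := cochainP w.
have mon_deg s : sdeg (size s) (mon s).
  elim: s => [|x s IH]; last by rewrite /mon big_cons; apply: sdegM_gen.
  exists 1%N, (fun=> 1), (fun _ _ => 0).
  by rewrite big_ord1 big_ord0 scale1r /mon big_nil.
have [phi [phil phiE]] : exists phi : sym g -> A, linear phi /\
    forall s, phi (mon s) = ce_fam s w.
  apply: (alt_lift (m := fun s => ce_fam s w)); split=> *.
    exact: ce_fam_lin.
  exact: ce_fam_swap.
have phiP : cochain_pred phi.
  apply/asboolP; split=> //; exists N.+1 => n hn Y [m [r [y ->]]].
  elim/big_ind: _ => [|u v hu hv|i _]; first exact: lin0.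
    by rewrite linD // hu hv addr0.
  rewrite linZ // -mon_enum phiE ce_fam_vanish ?scaler0 // => t.
  rewrite size_map size_enum_ord => ht; apply: (wN (size t)) => //.
  by rewrite -ltnS; apply: leq_trans ht.
exists (Cochain phiP) => n X /=.
by rewrite -mon_enum phiE ce_famE.
Qed.

Definition ce_diff (w : cochain g A) : cochain g A :=
  sval (cid (ce_diff_exists w)).

Lemma ce_diffP (w : cochain g A) : is_ce_diff w (ce_diff w).
Proof. exact: svalP (cid (ce_diff_exists w)). Qed.


End Differential.

(* Main.v *)
From HB Require Import structures.
Require Import Defs.
From mathcomp Require Import all_boot all_order all_algebra.
From mathcomp Require Import ring.
From mathcomp Require Import boolp classical_sets functions.

Set Implicit Arguments.
Unset Strict Implicit.
Unset Printing Implicit Defensive.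

Import GRing.Theory.
Local Open Scope ring_scope.

(* The differential is governed by one recursion on monomials: with
   L_x = iota_x d + d iota_x, the Chevalley-Eilenberg formula says that L_x is
   the usual Lie derivative, i.e. L_x w (1) = x (w (1)) and
   [L_x, iota_y] = iota_[x, y].  Any operator T that commutes or anticommutes
   with all the iota_x and satisfies T w (1) = 0 vanishes; this yields
   [L_x, L_y] = L_[x, y], [L_x, d] = 0, d^2 = 0, and the A-linearity of
   w |-> d (f w) - f d w, hence (a).  By the universal property of the
   symmetric superalgebra, iota extends uniquely to a module structure, and
   L_u = [iota_u, d] is forced.  The identity [L_u, iota_v] = iota_[u, v] holds
   for generators u, v by (a).  Both sides are derivations in v, and the identity
   is symmetric in (u, v) because [iota_u, iota_v] = 0, so it extends first to
   all v, then by symmetry to all u.  Finally L_[u, v] = [L_u, L_v] follows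
   by taking the commutator of this identity with d. *)

(** * Monomials and actions of the symmetric superalgebra *)

Section SymTheory.
Variables (R : comNzRingType) (M : lmodType R).

Definition mon (s : seq M) : sym M := \prod_(x <- s) sgen x.

Lemma mon_cons x s : mon (x :: s) = sgen x * mon s.
Proof. exact: big_cons. Qed.

Lemma mon_nil : mon [::] = 1.
Proof. exact: big_nil. Qed.

Lemma mon_cat s1 s2 : mon (s1 ++ s2) = mon s1 * mon s2.
Proof. exact: big_cat. Qed.

Lemma sgen0 : sgen 0 = 0 :> sym M.
Proof.
by have := sgenP (-1) (0 : M) 0; rewrite scaler0 addr0 scaleN1r addNr.
Qed.

Lemma sym_ind (P : sym M -> Prop) :
  (forall c x y, P x -> P y -> P (c *: x + y)) -> (forall s, P (mon s)) ->
  forall Y, P Y.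
Proof.
move=> PZ Pm Y; rewrite -(sreprK Y).
elim: (srepr Y) P PZ Pm => [r|x|t IHt u IHu|t IHt u IHu] P PZ Pm.
- rewrite spiC -[_%:A]addr0; apply: (PZ); first by rewrite -mon_nil.
  (* [P 0] comes from writing 0 as [-1 *: mon [::] + mon [::]]. *)
  by rewrite -(addNr (mon [::])) -scaleN1r; apply: (PZ).
- by rewrite -[spi _]mulr1 -mon_nil -mon_cons.
- by rewrite spiD -[spi t]scale1r; apply: (PZ); [apply: IHt|apply: IHu].
(* The predicate is generalized so that a product is handled one factor at a time: first the left
   factor becomes a monomial, then the right one, and a product of two monomials is a monomial. *)
- rewrite spiM; apply: (IHt (fun y => P (y * spi u))) => [c x y Px Py|s].
    by rewrite mulrDl -scalerAl; apply: (PZ).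
  apply: (IHu (fun y => P (mon s * y))) => [c x y Px Py|s'].
    by rewrite mulrDr -scalerAr; apply: (PZ).
  by rewrite -mon_cat.
Qed.

Lemma mon_ord n (X : 'I_n -> M) :
  mon [seq X i | i <- enum 'I_n] = \prod_(i < n) sgen (X i).
Proof. by rewrite /mon big_map enumT [index_enum _]unlock. Qed.

Lemma mon_sdeg s : sdeg (size s) (mon s).
Proof.
exists 1%N, (fun=> 1), (fun _ j => tnth (in_tuple s) j).
by rewrite big_ord1 scale1r /mon big_tnth.
Qed.

Lemma sdeg_ind n (P : sym M -> Prop) :
  P 0 -> (forall c x y, P x -> P y -> P (c *: x + y)) ->
  (forall s, size s = n -> P (mon s)) -> forall Y, sdeg n Y -> P Y.
Proof.
move=> P0 PZ Pm Y [m [r [x ->]]].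
elim/big_ind: _ => // [u v Pu Pv|i _].
  by rewrite -[u]scale1r; apply: (PZ).
rewrite -[_ *: _]addr0; apply: (PZ) => //; rewrite -mon_ord; apply: Pm.
by rewrite size_map size_enum_ord.
Qed.

(** * Universal property: pairwise anticommuting operators, linear in the generator, make [W] a
    module over the symmetric superalgebra *)

Section Action.
Variables (W : lmodType R) (e : M -> W -> W).

Fixpoint seval (t : sterm M) (w : W) : W :=
  match t with
  | SCst r => r *: w
  | SGen x => e x w
  | SAdd t u => seval t w + seval u w
  | SMul t u => seval t (seval u w)
  end.

Definition sact (Y : sym M) (w : W) : W := seval (srepr Y) w.

Hypotheses (e_linl : forall w, linear (e^~ w)) (e_linr : forall x, linear (e x)).
Hypothesis e_anti : forall x y w, e x (e y w) + e y (e x w) = 0.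

Let seval_lin t : linear (seval t).
Proof.
elim: t => [r|x|t IHt u IHu|t IHt u IHu] c v w /=.
- by rewrite scalerDr !scalerA mulrC.
- exact: e_linr.
- by rewrite IHt IHu scalerDr addrACA.
- by rewrite IHu IHt.
Qed.

Let sevalD t v w : seval t (v + w) = seval t v + seval t w.
Proof. by have := seval_lin t 1 v w; rewrite !scale1r. Qed.

Let sevalZ t c w : seval t (c *: w) = c *: seval t w.
Proof.
have s0 : seval t 0 = 0 by apply: (addIr (seval t 0)); rewrite -sevalD !add0r.
by rewrite -[c *: w]addr0 seval_lin s0 addr0.
Qed.

(** Each defining relation becomes an identity of operators: centrality of constants is linearity of
    the operators, and the anticommutation relation is [e_anti]. *)
Let seval_cong t u : scong t u -> seval t =1 seval u.
Proof.
elim=> {t u} /=.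
- by [].
- by move=> t u _ IH w; rewrite IH.
- by move=> t u v _ IH _ IH' w; rewrite IH IH'.
- by move=> t t' u u' _ IH _ IH' w; rewrite IH IH'.
- by move=> t t' u u' _ IH _ IH' w; rewrite IH' IH.
- by move=> t u v w; rewrite addrA.
- by move=> t u w; rewrite addrC.
- by move=> t w; rewrite scale0r add0r.
- by [].
- by move=> t w; rewrite !scale0r.
- by move=> t w; rewrite scale1r.
- by [].
- by move=> t u v w; rewrite sevalD.
- by move=> r s w; rewrite scalerDl.
- by move=> r s w; rewrite scalerA.
- by move=> r t w; rewrite sevalZ.
- by move=> x y w; have := e_linl w 1 x y; rewrite !scale1r.
- move=> r x w.
  have e0 : e 0 w = 0.
    by have := e_linl w (-1) 0 0; rewrite scaler0 addr0 scaleN1r addNr.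
  by have := e_linl w r x 0; rewrite !addr0 e0 addr0.
- by move=> x y w; rewrite scale0r e_anti.
Qed.

Lemma sact_spi t : sact (spi t) =1 seval t.
Proof. exact/seval_cong/srepr_pi. Qed.

Lemma sact_gen x w : sact (sgen x) w = e x w.
Proof. exact: sact_spi. Qed.

Lemma sactM Y Z w : sact (Y * Z) w = sact Y (sact Z w).
Proof. by rewrite -(sreprK Y) -(sreprK Z) -spiM !sact_spi. Qed.

Lemma sactD Y Z w : sact (Y + Z) w = sact Y w + sact Z w.
Proof. by rewrite -(sreprK Y) -(sreprK Z) -spiD !sact_spi. Qed.

Lemma sact_cst r w : sact r%:A w = r *: w.
Proof. by rewrite -spiC sact_spi. Qed.

Lemma sactZ r Y w : sact (r *: Y) w = r *: sact Y w.
Proof. by rewrite -[Y]mul1r scalerAl sactM sact_cst mul1r. Qed.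

Lemma sact_linr Y : linear (sact Y).
Proof. exact: seval_lin. Qed.

End Action.
End SymTheory.

(** * Cochains *)

Lemma linearDZ (R : nzRingType) (U W : lmodType R) (f : U -> W) : linear f ->
  [/\ {morph f : x y / x + y}, {morph f : x / - x}, f 0 = 0
    & forall c, {morph f : x / c *: x}].
Proof.
move=> lf.
have fD x y : f (x + y) = f x + f y by have := lf 1 x y; rewrite !scale1r.
have f0 : f 0 = 0 by apply: (addIr (f 0)); rewrite -fD !add0r.
have fZ c x : f (c *: x) = c *: f x by rewrite -[c *: x]addr0 lf f0 addr0.
by split=> // x; rewrite -!scaleN1r fZ.
Qed.

Lemma grading_parity_ind (F : fieldType) (V : lmodType F) (gr : nat -> set V)
    (b : bool) (P : V -> Prop) :
  P 0 -> (forall u v, P u -> P v -> P (u + v)) ->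
  (forall n v, odd n = b -> gr n v -> P v) ->
  forall v, grading_parity gr b v -> P v.
Proof.
move=> P0 PD Pgr v [N [y [yP ->]]].
by elim/big_ind: _ => // i /eqP ib; apply: Pgr ib (yP i).
Qed.

Section CochainTheory.
Variables (F : fieldType) (V : lmodType F) (A : comAlgType F).
Implicit Types (w : cochain V A) (x y : V) (f h : A).

Lemma cochain_addE w w' Y : (w + w') Y = w Y + w' Y. Proof. by []. Qed.
Lemma cochain_oppE w Y : (- w) Y = - w Y. Proof. by []. Qed.
Lemma cochain_scaleE (c : F) w Y : (c *: w) Y = c *: w Y. Proof. by []. Qed.
Lemma cochain_zeroE Y : (0 : cochain V A) Y = 0. Proof. by []. Qed.

Lemma cochain_sumE (I : Type) (r : seq I) (P : pred I) (y : I -> cochain V A) Y :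
  (\sum_(i <- r | P i) y i) Y = \sum_(i <- r | P i) y i Y.
Proof. by apply: (big_morph (fun w : cochain V A => w Y)). Qed.

Lemma cochain_ext w w' : (forall s, w (mon s) = w' (mon s)) -> w = w'.
Proof.
move=> ww'; apply: cochainE; apply: sym_ind => // c x y wx wy.
by rewrite !cochain_linear wx wy.
Qed.

Lemma contr_mon x w s : cochain_contr x w (mon s) = w (mon (x :: s)).
Proof. by rewrite mon_cons. Qed.

(** Rescaling [w] by a factor that depends only on the length of the monomial keeps the family
    alternating, so [alt_lift] applies. Kronecker deltas give the degree projections, and
    [(-1) ^+ n] gives the parity involution. *)
Lemma cochain_weight_exists (c : nat -> F) w :
  exists w' : cochain V A, forall s, w' (mon s) = c (size s) *: w (mon s).
Proof.
have [wD wN w0 wZ] := linearDZ (cochain_linear w).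
have [phi [phil phiE]] : exists phi : sym V -> A, linear phi /\
    forall s, phi (mon s) = c (size s) *: w (mon s).
  apply: alt_lift; split=> [s1 s2 k x y|s1 s2 x y].
    rewrite !size_cat /= !mon_cat !mon_cons sgenP mulrDl mulrDr.
    by rewrite -scalerAl -scalerAr cochain_linear scalerDr !scalerA mulrC.
  rewrite !size_cat /= !mon_cat !mon_cons !(mulrA (sgen _) (sgen _)).
  by rewrite (sgen_anti x) mulNr mulrN wN scalerN.
have [phiD phiN phi0 phiZ] := linearDZ phil.
have phiP : cochain_pred phi.
  apply/asboolP; split=> //; have /asboolP[_ [N wN']] := cochainP w; exists N => n hn.
  apply: sdeg_ind => // [k x y hx hy|s sn].
    by rewrite phil hx hy scaler0 addr0.
  by rewrite phiE (wN' n) ?scaler0 // -sn; exact: mon_sdeg.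
by exists (Cochain phiP).
Qed.

Definition weight (c : nat -> F) w : cochain V A :=
  sval (cid (cochain_weight_exists c w)).

Lemma weightE c w s : weight c w (mon s) = c (size s) *: w (mon s).
Proof. exact: (svalP (cid (cochain_weight_exists c w))). Qed.

Lemma weight_linear c : linear (weight c).
Proof.
move=> k w w'; apply: cochain_ext => s.
by rewrite weightE !cochain_addE !cochain_scaleE !weightE scalerDr !scalerA mulrC.
Qed.

Lemma cochain_grP k w :
  cochain_gr k w <-> forall s, size s != k -> w (mon s) = 0.
Proof.
have [_ _ w0 _] := linearDZ (cochain_linear w).
split=> [wk s sk|wk n nk]; first exact: wk (mon_sdeg s).
apply: sdeg_ind => // [c x y wx wy|s sn].
  by rewrite cochain_linear wx wy scaler0 addr0.
by apply: wk; rewrite sn.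
Qed.

Lemma cochain_parityP b w :
  cochain_parity b w <-> forall s, odd (size s) != b -> w (mon s) = 0.
Proof.
split=> [[N [y [yP ->]]] s sb|wb].
  rewrite cochain_sumE big1 // => i /eqP ib.
  have /cochain_grP := yP i; apply.
  by apply: contraNneq sb => ->; rewrite ib.
have /asboolP[_ [N wN]] := cochainP w.
(* The components are the projections of [w] to the single degrees; [N] bounds the degrees in which
   [w] is nonzero. *)
exists N, (fun n => weight (fun k => (k == n)%:R) w); split=> [n|].
  by apply/cochain_grP => s /negbTE sn; rewrite weightE sn scale0r.
apply: cochain_ext => s; rewrite cochain_sumE.
under eq_bigr do rewrite weightE.
case: (ltnP (size s) N) => [sN|Ns]; last first.
  rewrite (wN _ Ns _ (mon_sdeg s)) big1 // => i _; exact: scaler0.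
case: (eqVneq (odd (size s)) b) => [sb|sb]; last first.
  by rewrite wb // big1 // => i _; rewrite scaler0.
rewrite (bigD1 (Ordinal sN)) ?sb //= eqxx scale1r big1 ?addr0 // => i /andP[_ iN].
rewrite -val_eqE /= eq_sym in iN; by rewrite (negbTE iN) scale0r.
Qed.

Lemma cochain_gr_parity k w : cochain_gr k w -> cochain_parity (odd k) w.
Proof.
move=> /cochain_grP wk; apply/cochain_parityP => s sk; apply: wk.
by apply: contraNneq sk => ->.
Qed.

Lemma cochain_parity_submod b : is_submod (@cochain_parity F V A b).
Proof.
split=> [|c w w' /cochain_parityP wb /cochain_parityP w'b].
  exact/cochain_parityP.
apply/cochain_parityP => s sb.
by rewrite cochain_addE cochain_scaleE wb // w'b // scaler0 addr0.
Qed.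

Lemma cochain_superspace : is_superspace (@cochain_parity F V A).
Proof.
split=> [b|w|w /cochain_parityP w0 /cochain_parityP w1].
- exact: cochain_parity_submod.
- exists (weight (fun n => (~~ odd n)%:R) w), (weight (fun n => (odd n)%:R) w).
  split; last 1 first.
  + apply: cochain_ext => s; rewrite cochain_addE !weightE.
    by case: odd; rewrite !(scale0r, scale1r) ?addr0 ?add0r.
  + by apply/cochain_parityP => s; rewrite weightE; case: odd => //; rewrite scale0r.
  + by apply/cochain_parityP => s; rewrite weightE; case: odd => //; rewrite scale0r.
- apply: cochain_ext => s; case sb: (odd (size s)).
    by rewrite w0 ?sb.
  by rewrite w1 ?sb.
Qed.

Lemma cochain_grading : is_grading (@cochain_gr F V A).
Proof.
split=> [k|w|N y yP y0 n nN].
- split=> [|c w w' /cochain_grP wb /cochain_grP w'b]; first exact/cochain_grP.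
  apply/cochain_grP => s sb.
  by rewrite cochain_addE cochain_scaleE wb // w'b // scaler0 addr0.
- have /asboolP[_ [N wN]] := cochainP w.
  exists N, (fun n => weight (fun k => (k == n)%:R) w); split=> [n|].
    by apply/cochain_grP => s /negbTE sn; rewrite weightE sn scale0r.
  apply: cochain_ext => s; rewrite cochain_sumE.
  under eq_bigr do rewrite weightE.
  case: (ltnP (size s) N) => [sN|Ns]; last first.
    rewrite (wN _ Ns _ (mon_sdeg s)) big1 // => i _; exact: scaler0.
  rewrite (bigD1 (Ordinal sN)) //= eqxx scale1r big1 ?addr0 // => i iN.
  by rewrite -val_eqE /= eq_sym in iN; rewrite (negbTE iN) scale0r.
- apply: cochain_ext => s; rewrite cochain_zeroE.
  case: (eqVneq (size s) n) => [sn|sn]; last by have /cochain_grP := yP n; apply.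
  have := congr1 (fun w : cochain V A => w (mon s)) y0.
  rewrite /= cochain_sumE (bigD1 (Ordinal nN)) //= big1 ?addr0 // => i iN.
  have /cochain_grP := yP i; apply.
  by rewrite sn; rewrite -val_eqE /= eq_sym in iN.
Qed.

Lemma cochain_parityD b w w' :
  cochain_parity b w -> cochain_parity b w' -> cochain_parity b (w + w').
Proof.
by move=> wb w'b; rewrite -[w]scale1r; apply: (cochain_parity_submod b).2.
Qed.

Lemma contr_linear x : linear (@cochain_contr F V A x).
Proof. by move=> c w w'; apply: cochainE. Qed.

Lemma contr_linearl w : linear (fun x => cochain_contr x w).
Proof.
move=> c x y; apply: cochainE => Y; rewrite cochain_addE cochain_scaleE /=.
by rewrite sgenP mulrDl -scalerAl cochain_linear.
Qed.

Lemma contr_anti x y w :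
  cochain_contr x (cochain_contr y w) = - cochain_contr y (cochain_contr x w).
Proof.
apply: cochainE => Y; rewrite cochain_oppE /= !mulrA sgen_anti mulNr.
by have [_ -> _ _] := linearDZ (cochain_linear w).
Qed.

Lemma mul_linear f : linear (@cochain_mul F V A f).
Proof.
move=> c w w'; apply: cochainE => Y.
by change (f * (c *: w Y + w' Y) = c *: (f * w Y) + f * w' Y);
   rewrite mulrDr scalerAr.
Qed.

Lemma contr_mul x f w :
  cochain_contr x (cochain_mul f w) = cochain_mul f (cochain_contr x w).
Proof. exact: cochainE. Qed.

Lemma contr_gr x k w : cochain_gr k.+1 w -> cochain_gr k (cochain_contr x w).
Proof. by move=> /cochain_grP wk; apply/cochain_grP => s sk; rewrite contr_mon wk. Qed.

Lemma contr_gr0 x w : cochain_gr 0 w -> cochain_contr x w = 0.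
Proof. by move=> /cochain_grP wk; apply/cochain_ext => s; rewrite contr_mon wk. Qed.

Lemma mul_gr f k w : cochain_gr k w -> cochain_gr k (cochain_mul f w).
Proof. by move=> /cochain_grP wk; apply/cochain_grP => s sk; rewrite /= wk ?mulr0. Qed.

(** Peeling off a generator gives [T w (x s) = +/- T (contr x w) (s)], so induction on the monomial
    ends at the value on 1. The operator identities below are proved by applying this to the
    difference of their two sides. *)
Lemma cochain_op_eq0 (T : cochain V A -> cochain V A) :
  (forall w, T w 1 = 0) ->
  (forall w x, cochain_contr x (T w) = T (cochain_contr x w) \/
               cochain_contr x (T w) = - T (cochain_contr x w)) ->
  forall w, T w = 0.
Proof.
move=> T1 Tx w; apply: cochain_ext => s; rewrite cochain_zeroE.
elim: s w => [|x s IHs] w; first by rewrite mon_nil.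
by rewrite -contr_mon; case: (Tx w x) => ->; rewrite ?cochain_oppE IHs ?oppr0.
Qed.

End CochainTheory.

(** * The differential and the Lie derivatives *)

Section CartanCalculus.
Variables (F : fieldType) (g : lieAlgebra F) (A : comAlgType F).
Variable rho : derAction g A.
Implicit Types (w : cochain g A) (x y z : g) (f h : A).

Local Notation d := (ce_diff rho).
Local Notation contr := (@cochain_contr F g A).
Local Notation mul := (@cochain_mul F g A).

(* Locked to keep rewriting from mistaking it for a sum. *)
Definition lie_der x w : cochain g A := locked (contr x (d w) + d (contr x w)).

Lemma lie_derE x w : lie_der x w = contr x (d w) + d (contr x w).
Proof. by rewrite /lie_der -lock. Qed.

(** The value of [w] on the derivation [ad x] applied to the product of the [X j]; the sign comes
    from moving [[x, X j]] to the front. *)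
Let lie_subst n x (X : 'I_n -> g) (w : sym g -> A) : A :=
  \sum_(j < n) (-1) ^+ j *
     w (sgen (lie x (X j)) * \prod_(k < n | k != j) sgen (X k)).

Let prodS (n : nat) (P : pred 'I_n.+1) (f : 'I_n.+1 -> sym g) :
  \prod_(k < n.+1 | P k) f k = (if P ord0 then f ord0 else 1) *
  \prod_(k < n | P (lift ord0 k)) f (lift ord0 k).
Proof. by rewrite big_mkcond big_ord_recl -big_mkcond. Qed.

Let sumS (n : nat) (P : pred 'I_n.+1) (f : 'I_n.+1 -> A) :
  \sum_(k < n.+1 | P k) f k = (if P ord0 then f ord0 else 0) +
  \sum_(k < n | P (lift ord0 k)) f (lift ord0 k).
Proof. by rewrite big_mkcond big_ord_recl -big_mkcond. Qed.

(** This is [iota_x d = L_x - d iota_x] for [x = X ord0]: the terms that use [X ord0] as the acting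
    element or inside a bracket form the Lie derivative, and the others keep [X ord0] as a plain
    factor. *)
Let ce_formulaS n (X : 'I_n.+1 -> g) w :
  ce_formula rho X w =
  rho (X ord0) (w (\prod_(k < n) sgen (X (lift ord0 k))))
  - lie_subst (X ord0) (fun k => X (lift ord0 k)) w
  - ce_formula rho (fun k => X (lift ord0 k)) (contr (X ord0) w).
Proof.
have [wD wN w0 wZ] := linearDZ (cochain_linear w).
rewrite /ce_formula /lie_subst !big_ord_recl /= expr0 mul1r opprD !addrA.
congr (_ + _).
  rewrite -addrA [RHS]addrAC -!addrA; congr (_ + _).
    by rewrite prodS eqxx mul1r; congr (rho _ (w _)); apply: eq_bigl.
  rewrite sumS /= add0r -!sumrN; congr (_ + _); apply: eq_bigr => i _.
    rewrite prodS /= exprS mulN1r mulNr.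
    congr (- (_ * rho _ (w (_ * _)))).
  rewrite prodS /= mul1r exprS mulN1r mulNr.
  congr (- (_ * w (_ * _))).
rewrite -sumrN; apply: eq_bigr => i _; rewrite sumS /= add0r -sumrN.
apply: eq_bigr => j _.
(* Both indices shift by one, which leaves the sign unchanged; the minus comes from moving [X ord0]
   in front of the bracket. *)
rewrite prodS /= !mulrA (sgen_anti (X ord0)) mulNr wN mulrN opprK.
rewrite /bump /= !add1n addSn addnS !exprS !mulN1r opprK.
congr (_ * w (_ * _ * _)).
Qed.

Let lie_substS n x (X : 'I_n.+1 -> g) w :
  lie_subst x X w = w (sgen (lie x (X ord0)) * \prod_(k < n) sgen (X (lift ord0 k)))
  + lie_subst x (fun k => X (lift ord0 k)) (contr (X ord0) w).
Proof.
have [wD wN w0 wZ] := linearDZ (cochain_linear w).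
rewrite /lie_subst big_ord_recl expr0 mul1r; congr (_ + _).
  by rewrite prodS eqxx mul1r; congr (w (_ * _)); apply: eq_bigl.
apply: eq_bigr => j _; rewrite prodS /= exprS mulN1r !mulrA.
by rewrite (sgen_anti (X ord0)) !mulNr wN mulrN.
Qed.

Let ord_cons x n (X : 'I_n -> g) : exists X' : 'I_n.+1 -> g,
  X' ord0 = x /\ (fun k => X' (lift ord0 k)) = X.
Proof.
exists (fun i => if unlift ord0 i is Some j then X j else x).
by rewrite unlift_none; split=> //; apply/funext => i; rewrite liftK.
Qed.

Let lie_der_ord x n (X : 'I_n -> g) w :
  lie_der x w (\prod_(k < n) sgen (X k)) =
  rho x (w (\prod_(k < n) sgen (X k))) - lie_subst x X w.
Proof.
(* With [x] and [X] as head and tail of one family, the term [d (contr x w)] of [lie_der] cancels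
   the last term of [ce_formulaS]. *)
have [X' [<- <-]] := ord_cons x X.
have := ce_formulaS X' w; rewrite -!ce_diffP big_ord_recl => E.
by rewrite lie_derE cochain_addE /= E subrK.
Qed.

(** In the explicit formula for [lie_der], the action term only sees [contr y w]. Among the
    substitution terms, the one that replaces [y] by [[x, y]] gives the contraction by the bracket,
    and the others give [lie_der x (contr y w)]. *)
Lemma contr_lie_der x y w :
  contr y (lie_der x w) = lie_der x (contr y w) - contr (lie x y) w.
Proof.
apply: cochain_ext => s.
change (lie_der x w (sgen y * mon s) =
  lie_der x (contr y w) (mon s) - w (sgen (lie x y) * mon s)).
have -> : mon s = \prod_(k < size s) sgen (tnth (in_tuple s) k).
  by rewrite /mon big_tnth.
move: (size s) (tnth (in_tuple s)) => n X.
have [X' [<- <-]] := ord_cons y X; cbv beta.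
have := lie_der_ord x X' w; rewrite big_ord_recl => ->.
by rewrite lie_der_ord lie_substS /= opprD addrA addrAC.
Qed.

Lemma contr_diff x w : contr x (d w) = lie_der x w - d (contr x w).
Proof. by rewrite lie_derE addrK. Qed.

Lemma diff1 w : d w 1 = 0.
Proof.
have := @ce_diffP _ _ _ rho w 0%N (fun=> 0).
by rewrite /ce_formula !big_ord0 addr0.
Qed.

Lemma lie_der1 x w : lie_der x w 1 = rho x (w 1).
Proof.
have := @lie_der_ord x 0%N (fun=> 0) w.
by rewrite /lie_subst !big_ord0 subr0.
Qed.

Lemma diff_cons x s w :
  d w (mon (x :: s)) = lie_der x w (mon s) - d (contr x w) (mon s).
Proof. by rewrite -contr_mon contr_diff. Qed.

(** [ce_diff] is known only through its values on monomials, so linearity is an induction on the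
    monomial. It comes before linearity of [d] because the recursion for [lie_der] does not involve
    [d], whereas that for [d] involves [lie_der]. *)
Lemma lie_der_linear x : linear (lie_der x).
Proof.
move=> c w w'; apply: cochain_ext => s; rewrite cochain_addE cochain_scaleE.
elim: s w w' => [|y s IHs] w w'; first by rewrite mon_nil !lie_der1 dact_linr.
rewrite -!contr_mon !contr_lie_der !contr_linear !cochain_addE IHs !cochain_oppE.
by rewrite cochain_addE cochain_scaleE scalerDr scalerN opprD addrACA.
Qed.

Lemma diff_linear : linear d.
Proof.
move=> c w w'; apply: cochain_ext => s; rewrite cochain_addE cochain_scaleE.
elim: s w w' => [|y s IHs] w w'; first by rewrite mon_nil !diff1 scaler0 addr0.
rewrite !diff_cons lie_der_linear contr_linear IHs cochain_addE cochain_scaleE.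
by rewrite scalerBr opprD addrACA.
Qed.

Let contrB x w w' : contr x (w - w') = contr x w - contr x w'.
Proof. by have [fD fN _ _] := linearDZ (@contr_linear _ _ A x); rewrite fD fN. Qed.

Let lie_derB x w w' : lie_der x (w - w') = lie_der x w - lie_der x w'.
Proof. by have [fD fN _ _] := linearDZ (lie_der_linear x); rewrite fD fN. Qed.

Let diffB w w' : d (w - w') = d w - d w'.
Proof. by have [fD fN _ _] := linearDZ diff_linear; rewrite fD fN. Qed.

Let mulB f w w' : mul f (w - w') = mul f w - mul f w'.
Proof. by have [fD fN _ _] := linearDZ (@mul_linear _ g A f); rewrite fD fN. Qed.

Let evalE := (cochain_addE, cochain_oppE).

Let mulE f w Y : mul f w Y = f * w Y. Proof. by []. Qed.

Lemma contr_linl x y w : contr (x + y) w = contr x w + contr y w.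
Proof. by have [fD _ _ _] := linearDZ (contr_linearl w); rewrite fD. Qed.

Lemma lie_der_lie x y w :
  lie_der (lie x y) w = lie_der x (lie_der y w) - lie_der y (lie_der x w).
Proof.
pose T w := lie_der x (lie_der y w) - lie_der y (lie_der x w) - lie_der (lie x y) w.
apply/esym/eqP; rewrite -subr_eq0; apply/eqP; move: w.
apply: (@cochain_op_eq0 _ _ _ T) => [w|w z].
  by rewrite /T !evalE !lie_der1 dact_lie subrr.
left; rewrite /T; rewrite !(contrB, contr_lie_der, lie_derB).
(* The contractions by double brackets left over cancel by the Jacobi identity of [g]. *)
rewrite (lie_jacobi x y z) contr_linl; apply: cochainE => Y; rewrite !evalE; ring.
Qed.

Lemma diff_lie_der x w : d (lie_der x w) = lie_der x (d w).
Proof.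
pose T w := d (lie_der x w) - lie_der x (d w).
apply/eqP; rewrite -subr_eq0; apply/eqP; move: w.
apply: (@cochain_op_eq0 _ _ _ T) => [w|w z].
  by rewrite /T !evalE lie_der1 !diff1 dact0r subrr.
(* This [T] is odd, hence anticommutes with contractions up to the remainder [L_[x, z] -
   [L_x, L_z]], which vanishes by [lie_der_lie]. *)
right; rewrite /T; rewrite !(contrB, contr_lie_der, contr_diff, lie_derB, diffB).
rewrite lie_der_lie; apply: cochainE => Y; rewrite !evalE; ring.
Qed.

(** Applying [iota_x d = L_x - d iota_x] twice and using [[L_x, d] = 0] shows that [d d] commutes
    with contractions. *)
Lemma diff_diff w : d (d w) = 0.
Proof.
move: w; apply: cochain_op_eq0 => [w|w x]; first exact: diff1.
by left; rewrite !contr_diff diffB diff_lie_der opprB addrC subrK.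
Qed.

Lemma lie_der_mul x f w :
  lie_der x (mul f w) = mul (rho x f) w + mul f (lie_der x w).
Proof.
pose T w := lie_der x (mul f w) - mul (rho x f) w - mul f (lie_der x w).
apply/eqP; rewrite -subr_eq0 opprD addrA; apply/eqP; move: w.
apply: (@cochain_op_eq0 _ _ _ T) => [w|w z].
  rewrite /T !evalE /= lie_der1 lie_der1 /= dactM; ring.
left; rewrite /T; rewrite !(contrB, contr_lie_der, contr_mul, lie_derB, mulB).
apply: cochainE => Y; rewrite !evalE; ring.
Qed.

(* The exterior product of [df] and [w]. *)
Definition diff_mul f w : cochain g A := locked (d (mul f w) - mul f (d w)).

Lemma diff_mulE f w : diff_mul f w = d (mul f w) - mul f (d w).
Proof. by rewrite /diff_mul -lock. Qed.

Lemma diff_mul_linear f : linear (diff_mul f).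
Proof.
move=> c w w'; rewrite !diff_mulE mul_linear !diff_linear mul_linear.
by rewrite scalerBr opprD addrACA.
Qed.

Lemma contr_diff_mul x f w :
  contr x (diff_mul f w) = mul (rho x f) w - diff_mul f (contr x w).
Proof.
rewrite !diff_mulE contrB !contr_mul !contr_diff mulB lie_der_mul contr_mul.
apply: cochainE => Y; rewrite !evalE; ring.
Qed.

(** Exterior multiplication by [df] is A-linear. This is the identity [[[iota_f, d], iota_h] = 0],
    and it also lets coefficients pass through the [df] terms created by contraction with
    [f (x) x]. *)
Lemma diff_mul_mul f h w : diff_mul f (mul h w) = mul h (diff_mul f w).
Proof.
pose T w := diff_mul f (mul h w) - mul h (diff_mul f w).
apply/eqP; rewrite -subr_eq0; apply/eqP; move: w.
apply: (@cochain_op_eq0 _ _ _ T) => [w|w z].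
  by rewrite /T !diff_mulE !(evalE, mulE) !diff1; ring.
right; rewrite /T contrB !contr_mul !contr_diff_mul mulB contr_mul.
apply: cochainE => Y; rewrite !(evalE, mulE); ring.
Qed.

Lemma lie_der_gr x k w : cochain_gr k w -> cochain_gr k (lie_der x w).
Proof.
move=> wk; apply/cochain_grP => s; elim: s k w wk => [|y s IHs] k w wk sk.
  by rewrite mon_nil lie_der1 -mon_nil; have /cochain_grP -> := wk; rewrite ?dact0r.
rewrite -contr_mon contr_lie_der cochain_addE cochain_oppE (contr_mon (lie x y)).
have /cochain_grP -> // := wk; rewrite subr0.
case: k wk sk => [|k] wk sk.
  have [_ _ l0 _] := linearDZ (lie_der_linear x).
  by rewrite (contr_gr0 y wk) l0.
by apply: (IHs k); [apply: contr_gr|].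
Qed.

Lemma diff_gr k w : cochain_gr k w -> cochain_gr k.+1 (d w).
Proof.
move=> wk; apply/cochain_grP => s; elim: s k w wk => [|y s IHs] k w wk sk.
  by rewrite mon_nil diff1.
rewrite diff_cons; have /cochain_grP -> // := lie_der_gr y wk; rewrite sub0r.
case: k wk sk => [|k] wk sk.
  have [_ _ l0 _] := linearDZ diff_linear.
  by rewrite (contr_gr0 y wk) l0 oppr0.
by rewrite (IHs k) ?oppr0 //; apply: contr_gr.
Qed.

End CartanCalculus.

(** * Contraction by tensors *)

(* An alias, as [cochain] already carries its F-module structure. *)
Definition acochain (F : fieldType) (V : lmodType F) (A : comAlgType F) : Type :=
  cochain V A.

Section ACochain.
Variables (F : fieldType) (V : lmodType F) (A : comAlgType F).

HB.instance Definition _ := GRing.Zmodule.on (acochain V A).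

Fact acochain_scaleA a b (v : acochain V A) :
  cochain_mul a (cochain_mul b v) = cochain_mul (a * b) v.
Proof. by apply: cochainE => Y /=; rewrite mulrA. Qed.

Fact acochain_scale1 : left_id 1 (@cochain_mul F V A : A -> acochain V A -> acochain V A).
Proof. by move=> v; apply: cochainE => Y /=; rewrite mul1r. Qed.

Fact acochain_scaleDr :
  right_distributive (@cochain_mul F V A : A -> acochain V A -> acochain V A) +%R.
Proof. by move=> a; have [fD _ _ _] := linearDZ (@mul_linear _ V A a). Qed.

Fact acochain_scaleDl (v : acochain V A) :
  {morph (fun a => cochain_mul a v : acochain V A) : a b / a + b}.
Proof. by move=> a b; apply: cochainE => Y; rewrite cochain_addE /= mulrDl. Qed.

HB.instance Definition _ := GRing.Zmodule_isLmodule.Build A (acochain V A)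
  acochain_scaleA acochain_scale1 acochain_scaleDr acochain_scaleDl.

Lemma acochain_algE (c : F) (w : cochain V A) :
  c *: w = c%:A *: (w : acochain V A).
Proof.
by apply: cochainE => Y; change (c *: w Y = c%:A * w Y); rewrite mulr_algl.
Qed.

Definition tensor_contr (t : tensor A V) (w : acochain V A) : acochain V A :=
  tlift (fun f x => cochain_mul f (cochain_contr x w)) t.

Implicit Types (t u : tensor A V) (w : acochain V A) (f h : A).

Let contr_balanced w : balanced (fun (f : A) x => cochain_mul f (cochain_contr x w)).
Proof.
have [xD _ _ xZ] := linearDZ (contr_linearl (w : cochain V A)).
split=> [a a' y|a y y'|c a y]; apply: cochainE => Y.
- by rewrite cochain_addE /= mulrDl.
- by rewrite xD cochain_addE; change (a * (cochain_contr y w Y + cochain_contr y' w Y)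
  = a * cochain_contr y w Y + a * cochain_contr y' w Y); rewrite mulrDr.
- by rewrite xZ; change (c *: a * cochain_contr y w Y = a * (c *: cochain_contr y w Y));
  rewrite -scalerAl scalerAr.
Qed.

Lemma tensor_contr_pure f x w :
  tensor_contr (pure f x) w = cochain_mul f (cochain_contr x w).
Proof. exact: (tlift_pure (contr_balanced w)). Qed.

Lemma tensor_contrDl t u w :
  tensor_contr (t + u) w = tensor_contr t w + tensor_contr u w.
Proof. exact: (tliftD (contr_balanced w)). Qed.

Lemma tensor_contr0l w : tensor_contr 0 w = 0.
Proof. exact: (tlift0 (contr_balanced w)). Qed.

Lemma tensor_contrZl f t w : tensor_contr (f *: t) w = f *: tensor_contr t w.
Proof.
elim/tensor_ind: t => [|h x|t u IHt IHu].
- by rewrite scaler0 tensor_contr0l scaler0.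
- by rewrite scale_pure !tensor_contr_pure -acochain_scaleA.
- by rewrite scalerDr !tensor_contrDl IHt IHu scalerDr.
Qed.

Lemma tensor_contr_linearl w : linear (tensor_contr^~ w).
Proof. by move=> c t u; rewrite tensor_contrDl tensor_contrZl. Qed.

Lemma tensor_contr_linearr t : linear (tensor_contr t).
Proof.
move=> c v w; elim/tensor_ind: t => [|h x|t u IHt IHu].
- by rewrite !tensor_contr0l scaler0 addr0.
- rewrite !tensor_contr_pure; apply: cochainE => Y.
  change (h * (c * v (sgen x * Y) + w (sgen x * Y)) =
    c * (h * v (sgen x * Y)) + h * w (sgen x * Y)).
  by rewrite mulrDr mulrCA.
- by rewrite !tensor_contrDl IHt IHu scalerDr addrACA.
Qed.

Lemma tensor_contr_linear t :
  linear (tensor_contr t : cochain V A -> cochain V A).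
Proof.
move=> c v w.
by rewrite !acochain_algE tensor_contr_linearr.
Qed.

Lemma tensor_contr_mul t f w :
  tensor_contr t (cochain_mul f w) = cochain_mul f (tensor_contr t w).
Proof.
by have [_ _ _ ->] := linearDZ (tensor_contr_linearr t).
Qed.

Lemma tensor_contr_anti t u w :
  tensor_contr t (tensor_contr u w) + tensor_contr u (tensor_contr t w) = 0.
Proof.
have lD v := let: And4 fD _ _ _ := linearDZ (tensor_contr_linearr v) in fD.
have l0 v := let: And4 _ _ f0 _ := linearDZ (tensor_contr_linearr v) in f0.
elim/tensor_ind: t => [|f x|t t' IHt IHt']; first by rewrite !tensor_contr0l l0 addr0.
  elim/tensor_ind: u => [|h y|u u' IHu IHu'].
  - by rewrite !tensor_contr0l l0 addr0.
  - rewrite !tensor_contr_pure !contr_mul contr_anti; apply: cochainE => Y.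
    change (f * (h * - cochain_contr y (cochain_contr x w) Y)
      + h * (f * cochain_contr y (cochain_contr x w) Y) = 0); ring.
  - by rewrite !tensor_contrDl lD addrACA IHu IHu' addr0.
by rewrite !tensor_contrDl lD addrACA IHt IHt' addr0.
Qed.

Lemma tensor_contr_gr t k (w : cochain V A) :
  cochain_gr k.+1 w -> cochain_gr k (tensor_contr t w : cochain V A).
Proof.
move=> /cochain_grP wk; apply/cochain_grP => s sk.
elim/tensor_ind: t => [|f x|t u IHt IHu].
- by rewrite tensor_contr0l.
- by rewrite tensor_contr_pure /= -mon_cons wk ?mulr0.
- by rewrite tensor_contrDl cochain_addE IHt IHu addr0.
Qed.

Lemma tensor_contr_gr0 t (w : cochain V A) :
  cochain_gr 0 w -> tensor_contr t w = 0.
Proof.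
move=> /cochain_grP wk; apply: cochain_ext => s; rewrite cochain_zeroE.
elim/tensor_ind: t => [|f x|t u IHt IHu].
- by rewrite tensor_contr0l.
- by rewrite tensor_contr_pure /= -mon_cons wk ?mulr0.
- by rewrite tensor_contrDl cochain_addE IHt IHu addr0.
Qed.

Lemma tensor_contr_parity t :
  has_parity (@cochain_parity F V A) true (tensor_contr t).
Proof.
move=> b w /cochain_parityP wb; apply/cochain_parityP => s sb.
elim/tensor_ind: t => [|f x|t u IHt IHu].
- by rewrite tensor_contr0l.
- by rewrite tensor_contr_pure /= -mon_cons wb ?mulr0 //=; move: sb; case: odd; case: (b).
- by rewrite tensor_contrDl cochain_addE IHt IHu addr0.
Qed.

Lemma mul_parity f : has_parity (@cochain_parity F V A) false (@cochain_mul F V A f).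
Proof.
move=> b w /cochain_parityP wb; apply/cochain_parityP => s sb /=.
by rewrite wb ?mulr0.
Qed.

Lemma cochain_iotaE (t : tensor A V) f w :
  cochain_iota (t, f) w = tensor_contr t w + cochain_mul f w.
Proof. by []. Qed.

Lemma mul0 w : cochain_mul 0 w = 0.
Proof. by apply: cochainE => Y /=; rewrite mul0r. Qed.

End ACochain.

(** * Cartan formulas for tensors and the algebroid complex *)

Section TensorCartan.
Variables (F : fieldType) (g : lieAlgebra F) (A : comAlgType F).
Variable rho : derAction g A.
Implicit Types (w : cochain g A) (x y z : g) (f h : A) (t u : tensor A g).

Local Notation d := (ce_diff rho).
Local Notation contr := (@cochain_contr F g A).
Local Notation mul := (@cochain_mul F g A).
Local Notation tc := (@tensor_contr F g A : tensor A g -> cochain g A -> cochain g A).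

(** The Lie derivative along a pure tensor: [L_(f (x) x) = f L_x + df iota_x]. *)
Lemma tensor_contr_diff_pure f x w :
  tc (pure f x) (d w) + d (tc (pure f x) w) =
  mul f (lie_der rho x w) + diff_mul rho f (contr x w).
Proof.
rewrite !tensor_contr_pure diff_mulE contr_diff.
have [mD mN _ _] := linearDZ (@mul_linear _ g A f).
rewrite mD mN; apply: cochainE => Y; rewrite !(cochain_addE, cochain_oppE); ring.
Qed.

(** On pure tensors the three terms of [pure_br] have separate sources: [f h [x, y]] from
    [[L_x, iota_y]], [f x(h) y] from [L_x] acting on [h], and [- h y(f) x] from [iota_y] acting on
    [df]. *)
Lemma cartan_tensor t u w :
  tc t (d (tc u w)) + d (tc t (tc u w)) - tc u (tc t (d w) + d (tc t w)) =
  tc (tensor_br rho t u) w.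
Proof.
have [dD dN d0 _] := linearDZ (diff_linear rho).
have tD v := let: And4 fD _ _ _ := linearDZ (@tensor_contr_linear _ g A v) in fD.
have t0 v := let: And4 _ _ f0 _ := linearDZ (@tensor_contr_linear _ g A v) in f0.
elim/tensor_ind: t => [|f x|t t' IHt IHt'].
- by rewrite tensor_br0l !tensor_contr0l !d0 !addr0 t0 subr0.
- elim/tensor_ind: u => [|h y|u u' IHu IHu'].
  + by rewrite tensor_br0r !tensor_contr0l !(t0, d0) !addr0 subr0.
  + rewrite !tensor_contr_diff_pure tensor_br_pure /pure_br.
    have tN v : tc (- v) w = - tc v w.
      by apply/eqP; rewrite -addr_eq0 -tensor_contrDl addNr tensor_contr0l.
    rewrite !tensor_contrDl tN !tensor_contr_pure.
    have mD k := let: And4 fD _ _ _ := linearDZ (@mul_linear _ g A k) in fD.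
    have mN k := let: And4 _ fN _ _ := linearDZ (@mul_linear _ g A k) in fN.
    have cD k := let: And4 fD _ _ _ := linearDZ (@contr_linear _ g A k) in fD.
    have cN k := let: And4 _ fN _ _ := linearDZ (@contr_linear _ g A k) in fN.
    rewrite lie_der_mul !(cD, cN, contr_mul, diff_mul_mul, contr_lie_der, contr_diff_mul).
    (* The two remaining terms with [df] carry [iota_x iota_y] and [iota_y iota_x], and cancel. *)
    rewrite (contr_anti y x).
    have [_ -> _ _] := linearDZ (diff_mul_linear rho f).
    apply: cochainE => Y; rewrite !(mD, mN, cochain_addE, cochain_oppE) /=; ring.
  + rewrite tensor_brDr !tensor_contrDl !(tD, dD, IHu, IHu').
    rewrite -IHu -IHu' !tD; apply: cochainE => Y.
    rewrite !(cochain_addE, cochain_oppE); ring.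
- rewrite tensor_brDl !tensor_contrDl -IHt -IHt' !(tD, dD).
  apply: cochainE => Y; rewrite !(cochain_addE, cochain_oppE); ring.
Qed.

Lemma tensor_contr_diff_mul t f w :
  tc t (diff_mul rho f w) + diff_mul rho f (tc t w) = mul (tensor_act rho t f) w.
Proof.
have [DD _ D0 _] := linearDZ (diff_mul_linear rho f).
elim/tensor_ind: t => [|h x|t u IHt IHu].
- by rewrite !tensor_contr0l tensor_act0l D0 addr0 mul0.
- rewrite !tensor_contr_pure tensor_act_pure contr_diff_mul diff_mul_mul.
  have [mD mN _ _] := linearDZ (@mul_linear _ g A h).
  by rewrite mD mN subrK; apply: cochainE => Y /=; rewrite mulrA.
- rewrite !tensor_contrDl tensor_actDl DD addrACA IHt IHu.
  by apply: cochainE => Y; rewrite cochain_addE /= mulrDl.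
Qed.

Lemma ce_complex : is_complex (@cochain_parity F g A) d.
Proof.
split; [exact: cochain_superspace|exact: diff_linear| |exact: diff_diff].
have [dD _ d0 _] := linearDZ (diff_linear rho).
move=> b; apply: grading_parity_ind => [|u v ub vb|n w <- wn].
- by rewrite d0; have [p0 _] := @cochain_parity_submod F g A (true (+) b).
- by rewrite dD; apply: cochain_parityD.
- by rewrite addTb; apply: (cochain_gr_parity (diff_gr rho wn)).
Qed.

Lemma cochain_iota_linearl w :
  linear ((@cochain_iota F g A)^~ w : semi (tensor_algebroid rho) -> _).
Proof.
move=> c [t f] [u h].
change (tc (c%:A *: t + u) w + mul (c *: f + h) w =
  c *: (tc t w + mul f w) + (tc u w + mul h w)).
rewrite tensor_contrDl tensor_contrZl scalerDr addrACA; congr (_ + _ + _).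
  by apply: cochainE => Y; change (c%:A * tc t w Y = c *: tc t w Y); rewrite mulr_algl.
by apply: cochainE => Y; rewrite cochain_addE cochain_scaleE /= mulrDl scalerAl.
Qed.

Lemma cochain_iota_linearr (u : semi (tensor_algebroid rho)) :
  linear (cochain_iota u : cochain g A -> cochain g A).
Proof.
case: u => t f c v w; rewrite !cochain_iotaE mul_linear.
have -> : tc t (c *: v + w) = c *: tc t v + tc t w by apply: tensor_contr_linear.
by rewrite scalerDr addrACA.
Qed.

Lemma cartan_tensor_mul t f w :
  tc t (d (mul f w)) - tc t (mul f (d w)) + d (mul f (tc t w)) - mul f (d (tc t w)) =
  mul (tensor_act rho t f) w.
Proof.
have [tD tN _ _] := linearDZ (@tensor_contr_linear _ g A t).
by rewrite -tensor_contr_diff_mul !diff_mulE tD tN addrA.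
Qed.

Lemma ce_algebroid_complex : is_algebroid_complex (l := tensor_algebroid rho)
  (@cochain_parity F g A) d (@cochain_iota F g A).
Proof.
have [dD dN d0 _] := linearDZ (diff_linear rho).
have tD v := let: And4 fD _ _ _ := linearDZ (@tensor_contr_linear _ g A v) in fD.
have mD k := let: And4 fD _ _ _ := linearDZ (@mul_linear _ g A k) in fD.
have mN k := let: And4 _ fN _ _ := linearDZ (@mul_linear _ g A k) in fN.
have tN v := let: And4 _ fN _ _ := linearDZ (@tensor_contr_linear _ g A v) in fN.
have iE t f w : cochain_iota (t, f) w = tc t w + mul f w := cochain_iotaE t f w.
have i1 t w : cochain_iota (t, 0) w = tc t w by rewrite iE mul0 addr0.
have i2 f w : cochain_iota (0, f) w = mul f w by rewrite iE tensor_contr0l add0r.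
split; first split.
- exact: ce_complex.
- exact: cochain_iota_linearl.
- exact: cochain_iota_linearr.
(* In the flipped parity an odd element has zero function part and an even one has zero tensor part,
   so each homogeneous identity splits into pure cases. *)
- case=> -[t f] [/= p1 p2] b w wb.
    by rewrite p2 i1; apply: tensor_contr_parity.
  by rewrite p1 i2; apply: mul_parity.
- move=> a b [t f] [u h]; case: a => -[/= p1 p2]; case: b => -[/= p3 p4];
    apply/funext => w; rewrite /scomm /= ?expr1 ?expr0 ?scale1r ?scaleN1r ?opprK.
  + by rewrite p2 p4 !i1; apply: tensor_contr_anti.
  + by rewrite p2 p3 !(i1, i2); apply/eqP; rewrite subr_eq0 tensor_contr_mul.
  + by rewrite p1 p4 !(i1, i2); apply/eqP; rewrite subr_eq0 tensor_contr_mul.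
  + rewrite p1 p3 !i2; apply/eqP; rewrite subr_eq0; apply/eqP/cochainE => Y /=.
    by rewrite mulrCA.
- move=> a b [t f] [u h]; case: a => -[/= p1 p2]; case: b => -[/= p3 p4];
    apply/funext => w; rewrite /scomm /= ?expr1 ?expr0 ?scale1r ?scaleN1r ?opprK.
  all: rewrite /semi_br /=.
  + rewrite p2 p4 !tensor_act0r subr0 !i1; exact: cartan_tensor.
  + rewrite p2 p3 tensor_br0r tensor_act0l subr0 !(i1, i2) -cartan_tensor_mul.
    rewrite tensor_contr_mul mD; apply: cochainE => Y.
    rewrite !(cochain_addE, cochain_oppE).
    rewrite (tensor_contr_mul t h (d w)); ring.
  + rewrite p1 p4 tensor_br0l tensor_act0l sub0r !(i1, i2).
    have -> : mul (- tensor_act rho u f) w = - mul (tensor_act rho u f) w.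
      by apply: cochainE => Y; rewrite cochain_oppE /= mulNr.
    rewrite -cartan_tensor_mul tD tN; apply: cochainE => Y.
    rewrite !(cochain_addE, cochain_oppE); ring.
  + rewrite p1 p3 tensor_br0l !tensor_act0l subr0 !i2 mul0.
    (* For two functions the bracket is zero, and the required identity is the A-linearity of
       [diff_mul]. *)
    have /eqP := diff_mul_mul rho f h w; rewrite eq_sym -subr_eq0 !diff_mulE => /eqP.
    rewrite !(mD, mN) => E; apply: cochainE => Y; rewrite -E.
    rewrite !(cochain_addE, cochain_oppE) /=; ring.
- by move=> f h w; rewrite !i2; apply: cochainE => Y /=; rewrite mulrA.
- by move=> f X w; rewrite !i1 i2; apply: tensor_contrZl.
Qed.
End TensorCartan.

(** * The calculus structure *)

Section Signs.
Variables (F : fieldType) (V : lmodType F) (A : comAlgType F).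
Implicit Types (w : cochain V A).

Definition grade_sign w : cochain V A := weight (fun n => (-1) ^+ n) w.

Lemma grade_sign_linear : linear grade_sign.
Proof. exact: weight_linear. Qed.

Lemma grade_signK : involutive grade_sign.
Proof.
move=> w; apply: cochain_ext => s.
by rewrite !weightE scalerA -exprD addnn -mul2n exprM sqrrN !expr1n scale1r.
Qed.

Lemma grade_sign_contr t w :
  grade_sign (tensor_contr t w) = - tensor_contr t (grade_sign w).
Proof.
have [sD _ s0 _] := linearDZ grade_sign_linear.
elim/tensor_ind: t => [|f x|t u IHt IHu].
- by rewrite !tensor_contr0l s0 oppr0.
- rewrite !tensor_contr_pure; apply: cochain_ext => s.
  rewrite cochain_oppE weightE /= -mon_cons weightE /= exprS mulN1r.
  by rewrite scaleNr mulrN opprK scalerAr.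
- by rewrite !tensor_contrDl sD IHt IHu opprD.
Qed.

Lemma grade_sign_mul f w :
  grade_sign (cochain_mul f w) = cochain_mul f (grade_sign w).
Proof. by apply: cochain_ext => s; rewrite weightE /= weightE scalerAr. Qed.

End Signs.

(** * Contraction and Lie derivative along arbitrary chains *)

Section Contraction.
Variables (F : fieldType) (g : lieAlgebra F) (A : comAlgType F).
Variable rho : derAction g A.
Local Notation G := (schouten_space (tensor_algebroid rho)).
Local Notation parity := (@schouten_parity F A (tensor_algebroid rho)).
Local Notation d := (ce_diff rho).
Local Notation mul := (@cochain_mul F g A).
Local Notation tc := (@tensor_contr F g A : tensor A g -> cochain g A -> cochain g A).
Implicit Types (u v : G) (w : cochain g A).

(** The module structure given by the universal property over [A], where [A] acts on cochains by
    multiplication. *)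
Definition schouten_contr (u : G) (w : cochain g A) : cochain g A :=
  sact (@tensor_contr F g A) (u : sym (tensor A g)) w.

Let linl := @tensor_contr_linearl F g A.
Let linr := @tensor_contr_linearr F g A.
Let anti := @tensor_contr_anti F g A.

Local Notation I := schouten_contr.

Lemma schouten_contr_gen (t : tensor A g) w : I (sgen t) w = tc t w.
Proof. exact: (sact_gen linl linr anti). Qed.

Lemma schouten_contrM u v w : I (schouten_wedge u v) w = I u (I v w).
Proof. exact: (sactM linl linr anti). Qed.

Lemma schouten_contrD u v w : I (u + v) w = I u w + I v w.
Proof. exact: (sactD linl linr anti (u : sym (tensor A g)) v). Qed.

Lemma schouten_contr_cst (f : A) w : I (f%:A : sym (tensor A g)) w = mul f w.
Proof. exact: (sact_cst linl linr anti). Qed.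

Lemma schouten_contrZ (f : A) (Y : sym (tensor A g)) w : I (f *: Y) w = mul f (I Y w).
Proof. exact: (sactZ linl linr anti). Qed.

Lemma schouten_contr_linearr u : linear (I u).
Proof.
move=> c v w.
by rewrite !acochain_algE; exact: (sact_linr linr).
Qed.

Lemma schouten_contr_linearl w : linear (I^~ w).
Proof.
move=> c u v; rewrite schouten_contrD; congr (_ + _).
change (I (c%:A *: (u : sym (tensor A g))) w = c *: I u w).
rewrite schouten_contrZ; apply: cochainE => Y.
by change (c%:A * I u w Y = c *: I u w Y); rewrite mulr_algl.
Qed.

Lemma schouten_contr_incl (u : semi (tensor_algebroid rho)) w :
  I (schouten_incl u) w = cochain_iota u w.
Proof.
case: u => t f; rewrite schouten_contrD.
by rewrite (schouten_contr_gen t) (schouten_contr_cst f).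
Qed.

Lemma schouten_contr_gr m n u w : schouten_gr m u -> cochain_gr n w ->
  gr_sub (@cochain_gr F g A) n m (I u w).
Proof.
move=> um wn; rewrite /gr_sub.
have [subgr _ _] := @cochain_grading F g A.
have grD k (w1 w2 : cochain g A) : cochain_gr k w1 -> cochain_gr k w2 ->
    cochain_gr k (w1 + w2).
  by move=> h1 h2; rewrite -[w1]scale1r; apply: (subgr k).2.
move: (u : sym (tensor A g)) um; apply: sdeg_ind.
- have [_ _ -> _] := linearDZ (schouten_contr_linearl w).
  by case: ifP => // _; exact: (subgr _).1.
- move=> c x y; rewrite (schouten_contrD (c *: x)) schouten_contrZ.
  case: ifP => _ => [hx hy|-> ->].
    by apply: grD => //; apply: mul_gr.
  by have [_ _ -> _] := linearDZ (@mul_linear _ g A c); rewrite addr0.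
- move=> s; elim: s m => [|t s IHs] m <- /=.
    rewrite mon_nil -[1]scale1r (schouten_contr_cst 1) /= subn0.
    by apply: mul_gr.
  rewrite mon_cons (schouten_contrM (sgen t)) schouten_contr_gen.
  (* If [size s < n], contraction by [t] lowers the degree once more; if [size s > n], the cochain
     is already zero; if they are equal, it has degree 0 and [t] kills it. *)
  have := IHs _ erefl; case: (ltngtP (size s) n) => sn.
  + move=> h; apply: tensor_contr_gr; by rewrite -subSn // subSS.
  + move=> ->; by have [_ _ -> _] := linearDZ (@tensor_contr_linear _ g A t).
  + by rewrite sn subnn; apply: tensor_contr_gr0.
Qed.

Lemma schouten_gr_parity m u : schouten_gr m u -> parity (odd m) u.
Proof.
move=> um; exists m.+1, (fun n => if n == m then u else 0); split=> [n|].
  case: eqP => [-> //|_].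
  by exists 0%N, (fun=> 0), (fun _ _ => 0); rewrite big_ord0.
rewrite (bigD1 ord_max) //= eqxx big1 ?addr0 // => i /andP[_].
by rewrite -val_eqE /= => /negbTE ->.
Qed.

(** A monomial of length [n] acts by [n] contractions, each anticommuting with the involution, and
    [(-1) ^+ n] depends only on the parity of [n]. *)
Lemma grade_sign_schouten_contr a u w : parity a u ->
  grade_sign (I u w) = (-1) ^+ a *: I u (grade_sign w).
Proof.
have [sD _ s0 _] := linearDZ (@grade_sign_linear F g A).
move: u; apply: grading_parity_ind.
- have ID (w' : cochain g A) := linearDZ (schouten_contr_linearl w').
  have [_ _ -> _] := ID w; have [_ _ -> _] := ID (grade_sign w).
  by rewrite s0 scaler0.
- by move=> u v hu hv; rewrite !schouten_contrD sD hu hv scalerDr.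
- move=> n u <- /=; rewrite signr_odd; move: u; apply: sdeg_ind.
  + have ID (w' : cochain g A) := linearDZ (schouten_contr_linearl w').
    have [_ _ -> _] := ID w; have [_ _ -> _] := ID (grade_sign w).
    by rewrite s0 scaler0.
  + move=> c x y hx hy; rewrite !(schouten_contrD (c *: x)) !schouten_contrZ.
    rewrite sD grade_sign_mul hx hy scalerDr; congr (_ + _).
    by have [_ _ _ ->] := linearDZ (@mul_linear _ g A c).
  + move=> s; elim: s n => [|t s IHs] n <- /=.
      by rewrite mon_nil -[1]scale1r !(schouten_contr_cst 1) grade_sign_mul scale1r.
    rewrite mon_cons !(schouten_contrM (sgen t)) !schouten_contr_gen.
    rewrite grade_sign_contr (IHs _ erefl).
    have [_ _ _ ->] := linearDZ (@tensor_contr_linear _ g A t).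
    by rewrite exprS mulN1r scaleNr.
Qed.

(* On elements of parity [a] this is [schouten_contr u, d]; conjugation by
   [grade_sign] makes the sign [(-1) ^+ a] linear in [u]. *)
Definition schouten_lie (u : G) (w : cochain g A) : cochain g A :=
  locked (I u (d w) - d (grade_sign (I u (grade_sign w)))).

Lemma schouten_lieE a u w : parity a u ->
  schouten_lie u w = I u (d w) - (-1) ^+ a *: d (I u w).
Proof.
move=> ua; rewrite /schouten_lie -lock (grade_sign_schouten_contr _ ua) grade_signK.
by have [_ _ _ ->] := linearDZ (diff_linear rho).
Qed.

Lemma schouten_lie_linearl w : linear (schouten_lie^~ w).
Proof.
move=> c u v; rewrite /schouten_lie -!lock !schouten_contr_linearl.
by rewrite grade_sign_linear diff_linear scalerBr opprD addrACA.
Qed.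

Lemma schouten_lie_linearr u : linear (schouten_lie u).
Proof.
move=> c v w; rewrite /schouten_lie -!lock.
rewrite !(diff_linear, grade_sign_linear, schouten_contr_linearr).
by rewrite scalerBr opprD addrACA.
Qed.

End Contraction.

(** * The commutation identities with a Schouten bracket *)

Section CalculusIdentities.
Variables (F : fieldType) (g : lieAlgebra F) (A : comAlgType F).
Variable rho : derAction g A.
Local Notation l := (tensor_algebroid rho).
Local Notation G := (schouten_space l).
Local Notation parity := (@schouten_parity F A l).
Local Notation wedge := (@schouten_wedge F A l).
Local Notation d := (ce_diff rho).
Local Notation I := (@schouten_contr F g A rho).
Local Notation L := (@schouten_lie F g A rho).
Variable br : G -> G -> G.
Hypothesis br_schouten : is_schouten br.
Implicit Types (u v : G) (w : cochain g A) (a b c : bool).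

Let ger := gger_gerstenhaber (schouten_gerstenhaber br_schouten).

Let parityM a b u v : parity a u -> parity b v -> parity (a (+) b) (wedge u v).
Proof. exact: (ger_wedge_par ger). Qed.

Let parityP b (k : F) u v : parity b u -> parity b v -> parity b (k *: u + v).
Proof. exact: (super_submod (ger_superspace ger) b).2. Qed.

Let parity0 b : parity b 0.
Proof. exact: (super_submod (ger_superspace ger) b).1. Qed.

Let parityD b u v : parity b u -> parity b v -> parity b (u + v).
Proof. by move=> ub; rewrite -[u]scale1r; apply: parityP. Qed.

Let parity_cst (f : A) : parity false (f%:A : sym (tensor A g)).
Proof.
apply: (@schouten_gr_parity _ _ _ rho 0).
by exists 1%N, (fun=> f), (fun _ _ => 0); rewrite big_ord1 big_ord0.
Qed.

Let parity_gen (t : tensor A g) : parity true (sgen t : sym (tensor A g)).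
Proof.
apply: (@schouten_gr_parity _ _ _ rho 1).
by exists 1%N, (fun=> 1), (fun _ _ => t); rewrite !big_ord1 scale1r.
Qed.

(* [L_u, iota_v] = iota_[u, v], solved for L_u iota_v. *)
Definition cartan a b u v : Prop := forall w,
  L u (I v w) = I (br u v) w + (-1) ^+ (~~ a && b) *: I v (L u w).

Let contrC a b u v w : parity a u -> parity b v ->
  I u (I v w) = (-1) ^+ (a && b) *: I v (I u w).
Proof.
move=> ua vb; rewrite -!schouten_contrM (ger_wedgeC ger ua vb).
by have [_ _ _ ->] := linearDZ (@schouten_contr_linearl F g A rho w).
Qed.

Let brC a b u v w : parity a u -> parity b v ->
  I (br v u) w = - ((-1) ^+ (~~ a && ~~ b) *: I (br u v) w).
Proof.
move=> ua vb.
have fu : flip parity (~~ a) u by rewrite /flip negbK.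
have fv : flip parity (~~ b) v by rewrite /flip negbK.
rewrite (lsa_skew (ger_lie ger) fv fu) andbC.
by have [_ -> _ ->] := linearDZ (@schouten_contr_linearl F g A rho w).
Qed.

Lemma cartan_sym a b u v : parity a u -> parity b v ->
  cartan a b u v -> cartan b a v u.
Proof.
move=> ua vb uv w; rewrite (brC _ ua vb).
have [iuD iuN _ _] := linearDZ (schouten_contr_linearr u).
have [ivD ivN _ _] := linearDZ (schouten_contr_linearr v).
have [dD dN _ _] := linearDZ (diff_linear rho).
have := uv w; rewrite !(schouten_lieE _ ua) !(schouten_lieE _ vb).
(* Supercommutation of the contractions is used at both [w] and [d w], because [L] has one term with
   [d] on each side. *)
have := contrC w ua vb; have := contrC (d w) ua vb.
case: (a); case: (b); rewrite /= ?expr1 ?expr0 ?scale1r ?scaleN1r.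
all: rewrite !(iuD, iuN, ivD, ivN, dD, dN) => E1 E2 /esym /(canRL (addrK _)) ->.
all: rewrite E2 ?dN E1; apply: cochainE => Y; rewrite !(cochain_addE, cochain_oppE); ring.
Qed.

(** Moving [L u] past [I v] and then past [I v'] produces the two terms of the Leibniz rule for the
    bracket; the signs multiply accordingly. *)
Lemma cartan_wedge a b c u v v' : parity a u -> parity b v -> parity c v' ->
  cartan a b u v -> cartan a c u v' -> cartan a (b (+) c) u (wedge v v').
Proof.
move=> ua vb v'c uv uv' w.
rewrite !schouten_contrM uv uv' (ger_leibniz ger _ ua vb).
have [ID _ _ IZ] := linearDZ (@schouten_contr_linearl F g A rho w).
have [vD _ _ vZ] := linearDZ (schouten_contr_linearr v).
rewrite ID IZ !schouten_contrM vD vZ scalerDr scalerA addrA.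
congr (_ + _ + _ *: _).
by case: (a); case: (b); case: (c); rewrite /= ?mulr1 ?mul1r ?mulrNN ?mulr1.
Qed.

Lemma cartan_ind a u : parity a u ->
  (forall f : A, cartan a false u (f%:A : sym (tensor A g))) ->
  (forall t : tensor A g, cartan a true u (sgen t : sym (tensor A g))) ->
  forall b v, parity b v -> cartan a b u v.
Proof.
move=> ua uf ut b.
have [LD _ L0 LZ] := linearDZ (schouten_lie_linearr u).
have brlin w (k : F) v v' : I (br u (k *: v + v')) w = k *: I (br u v) w + I (br u v') w.
  by rewrite (lsa_linr (ger_lie ger)) (@schouten_contr_linearl F g A rho w).
have D b' v v' : cartan a b' u v -> cartan a b' u v' -> cartan a b' u (v + v').
  move=> h h' w; rewrite schouten_contrD LD h h'.
  have := brlin w 1 v v'; rewrite !scale1r => ->.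
  by rewrite schouten_contrD scalerDr addrACA.
have Z b' : cartan a b' u 0.
  move=> w; have := brlin w (-1) 0 0; rewrite scaler0 addr0 scaleN1r addNr => ->.
  have [_ _ i0 _] := linearDZ (@schouten_contr_linearl F g A rho w).
  have [_ _ j0 _] := linearDZ (@schouten_contr_linearl F g A rho (L u w)).
  by rewrite i0 j0 L0 scaler0 addr0.
apply: grading_parity_ind => [||n v <-]; [exact: Z|by move=> *; apply: D|].
(* The parity is carried through the induction because [cartan_wedge] requires homogeneous factors;
   a coefficient [f] is treated as the even factor [f%:A]. *)
pose P (v : G) := parity (odd n) v /\ cartan a (odd n) u v.
suff h : @sdeg A (tensor A g) n v -> P v by move=> /h[].
apply: sdeg_ind.
- by split.
- move=> f x y [px cx] [py cy]; split.
    apply: parityD => //.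
    have := parityM (parity_cst f) px; rewrite /schouten_wedge /=.
    by rewrite mulr_algl.
  apply: D => //; rewrite -[f *: x]mulr_algl.
  exact: (@cartan_wedge a false (odd n) u (f%:A : sym _) x ua (parity_cst f) px).
- rewrite /P; move=> s; elim: s n {v P} => [|t s IHs] n <- /=.
    by rewrite mon_nil -[1]scale1r; split; [exact: parity_cst|exact: uf].
  have [ps cs] := IHs _ erefl; rewrite mon_cons -addTb; split.
    exact: (parityM (parity_gen t) ps).
  exact: (@cartan_wedge a true _ u _ _ ua (parity_gen t) ps).
Qed.

(** This is the bracket axiom of the algebroid complex, read through the inclusion, on which the
    Schouten bracket restricts to [semi_br]. *)
Lemma cartan_incl (u v : semi l) a b :
  flip (@semi_parity F A l) a u -> flip (@semi_parity F A l) b v ->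
  parity a (schouten_incl u) -> cartan a b (schouten_incl u) (schouten_incl v).
Proof.
move=> ua vb pu w.
have := lcx_br (acx_lie_complex (ce_algebroid_complex rho)) ua vb.
move=> /(congr1 (fun T => T w)); rewrite (schouten_extends br_schouten).
rewrite (schouten_contr_incl (semi_br u v)) => <-.
rewrite !(schouten_lieE _ pu) /scomm !schouten_contr_incl andbT.
by rewrite subrK.
Qed.

Let incl_cst (f : A) : @schouten_incl F A l (0, f) = (f%:A : sym (tensor A g)).
Proof.
by rewrite /schouten_incl /= sgen0 add0r.
Qed.

Let incl_gen (t : tensor A g) :
  @schouten_incl F A l (t, 0) = (sgen t : sym (tensor A g)).
Proof. by rewrite /schouten_incl /= scale0r addr0. Qed.

Let incl_ind (P : bool -> G -> Prop) :
  (forall a (u : semi l), flip (@semi_parity F A l) a u ->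
     parity a (schouten_incl u) -> P a (schouten_incl u)) ->
  (forall f : A, P false (f%:A : sym (tensor A g))) /\
  (forall t : tensor A g, P true (sgen t : sym (tensor A g))).
Proof.
move=> h; split=> [f|t].
  by rewrite -incl_cst; apply: h; [split|rewrite incl_cst; exact: parity_cst].
by rewrite -incl_gen; apply: h; [split|rewrite incl_gen; exact: parity_gen].
Qed.

Lemma cartanP a b u v : parity a u -> parity b v -> cartan a b u v.
Proof.
move=> ua vb; pose P c (x : G) := parity c x /\ cartan a c u x.
have [Pf Pt] : (forall f : A, P false (f%:A : sym (tensor A g))) /\
    (forall t : tensor A g, P true (sgen t : sym (tensor A g))).
  (* For a generator [x], the identity for [(x, y)] with [y] a generator extends to [(x, u)];
     symmetry turns it into [(u, x)], which a second use of [cartan_ind] extends to [(u, v)]. *)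
  apply: incl_ind => c x xc px; split=> //; apply: (cartan_sym px ua).
  have [xf xt] := @incl_ind (fun b => cartan c b (schouten_incl x))
    (fun b y yb _ => cartan_incl xc yb px).
  exact: (cartan_ind px xf xt ua).
exact: (cartan_ind ua (fun f => (Pf f).2) (fun t => (Pt t).2) vb).
Qed.

(** [L u] is a supercommutator with [d], so it supercommutes with [d] because [d d = 0]. *)
Lemma diff_schouten_lie a u w : parity a u ->
  d (L u w) = - ((-1) ^+ a *: L u (d w)).
Proof.
move=> ua; rewrite !(schouten_lieE _ ua) diff_diff.
have [_ _ i0 _] := linearDZ (schouten_contr_linearr u).
have [dD dN _ dZ] := linearDZ (diff_linear rho).
rewrite i0 dD dN dZ diff_diff scaler0 subr0 sub0r scalerN opprK scalerA.
by rewrite -expr2 sqrr_sign scale1r.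
Qed.

Lemma schouten_lie_br a b u v w : flip parity a u -> flip parity b v ->
  L (br u v) w = scomm a b (L u) (L v) w.
Proof.
move=> ua vb; have uv := cartanP ua vb; have dL x := diff_schouten_lie x ua.
have puv := lsa_par (ger_lie ger) ua vb.
rewrite /scomm (schouten_lieE _ puv) !(schouten_lieE _ vb).
have {uv} E x : I (br u v) x = L u (I v x) - (-1) ^+ (~~ ~~ a && ~~ b) *: I v (L u x).
  by rewrite (uv x) addrK.
have [iD iN _ _] := linearDZ (schouten_contr_linearr v).
have [dD dN _ _] := linearDZ (diff_linear rho).
have [LD LN _ _] := linearDZ (schouten_lie_linearr u).
(* Since [d] supercommutes with [L u], taking the commutator of [[L_u, iota_v]] with [d] only
   affects [iota_v], which becomes [L_v]. *)
rewrite !E; have := dL (I v w); have := dL w.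
case: (a); case: (b); rewrite /= ?expr1 ?expr0 ?scale1r ?scaleN1r ?opprK => F1 F2.
all: rewrite !(iD, iN, dD, dN, LD, LN, F1, F2).
all: apply: cochainE => Y; rewrite !(cochain_addE, cochain_oppE); ring.
Qed.

End CalculusIdentities.

(** * Existence of the graded calculus *)

Section Calculus.
Variables (F : fieldType) (g : lieAlgebra F) (A : comAlgType F).
Variable rho : derAction g A.
Local Notation l := (tensor_algebroid rho).
Local Notation G := (schouten_space l).
Local Notation parity := (@schouten_parity F A l).
Local Notation wedge := (@schouten_wedge F A l).
Local Notation d := (ce_diff rho).
Local Notation I := (@schouten_contr F g A rho).
Local Notation L := (@schouten_lie F g A rho).
Variable br : G -> G -> G.
Hypothesis br_schouten : is_schouten br.

Lemma schouten_graded_calculus : is_graded_calculus parity wedge br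
  (@cochain_parity F g A) d (@schouten_gr F A l) (@cochain_gr F g A) I L.
Proof.
have superG := ger_superspace (gger_gerstenhaber (schouten_gerstenhaber br_schouten)).
have diff_gr_sub m n w : gr_sub (@cochain_gr F g A) n m w ->
    gr_sub (@cochain_gr F g A) n.+1 m (d w).
  (* The boundary case is [m = n + 1]: the source is then zero, while the target is the component of
     degree 0. *)
  rewrite /gr_sub; case: (ltngtP m n.+1) => mn.
  - by rewrite -ltnS mn subSn //; apply: diff_gr.
  - rewrite leqNgt (ltn_trans _ mn) //= => ->.
    by have [_ _ -> _] := linearDZ (diff_linear rho).
  - rewrite mn ltnn subnn => ->; have [_ _ -> _] := linearDZ (diff_linear rho).
    exact/cochain_grP.
have contr_par a u : parity a u -> has_parity (@cochain_parity F g A) a (I u).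
  move=> ua b w wb.
  have par0 c : cochain_parity c (0 : cochain g A) by apply/cochain_parityP.
  move: u ua; apply: grading_parity_ind => [|u v pu pv|m u <- um].
  - by have [_ _ -> _] := linearDZ (@schouten_contr_linearl F g A rho w).
  - by rewrite schouten_contrD; apply: cochain_parityD.
  have [iD _ i0 _] := linearDZ (schouten_contr_linearr u).
  move: w wb; apply: grading_parity_ind => [|v w pv pw|n w <- wn].
  - by rewrite i0.
  - by rewrite iD; apply: cochain_parityD.
  have := schouten_contr_gr um wn; rewrite /gr_sub; case: leqP => [mn|_ ->//].
  by rewrite addbC -oddB //; apply: cochain_gr_parity.
have diff_par b w : cochain_parity b w -> cochain_parity (~~ b) (d w).
  exact: (complex_odd (ce_complex rho)).
split; first split.
- exact: ce_complex.
- exact: schouten_contr_linearl.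
- exact: schouten_contr_linearr.
- exact: contr_par.
- exact: schouten_contrM.
- exact: schouten_lie_linearl.
- exact: schouten_lie_linearr.
- move=> a u ua b w wb; rewrite (schouten_lieE _ ua).
  rewrite addrC -scaleNr; apply: (@cochain_parity_submod F g A (a (+) b)).2.
    by have := diff_par _ _ (contr_par _ _ ua _ _ wb); rewrite -addNb negbK.
  by have := contr_par _ _ ua _ _ (diff_par _ _ wb); rewrite addbN -addNb negbK.
- by move=> a b u v ua vb; apply/funext => w; apply: schouten_lie_br.
- move=> a b u v ua vb; apply/funext => w.
  by rewrite /scomm (cartanP br_schouten ua vb) negbK addrK.
- by move=> a u ua; apply/funext => w; rewrite (schouten_lieE _ ua) /scomm andbT.
- exact: cochain_grading.
- by move=> n w; apply: diff_gr.
- by move=> m n u w; apply: schouten_contr_gr.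
- move=> m n u w um wn; rewrite (schouten_lieE _ (schouten_gr_parity um)).
  have h1 := diff_gr_sub _ _ _ (schouten_contr_gr um wn).
  have h2 := schouten_contr_gr um (diff_gr rho wn).
  move: h1 h2; rewrite /gr_sub; case: ifP => _ => [h1 h2|-> ->]; last first.
    by rewrite scaler0 subr0.
  rewrite addrC -scaleNr; have [subgr _ _] := @cochain_grading F g A.
  exact: (subgr _).2.
Qed.

End Calculus.

(** * Uniqueness of the calculus *)

Section Uniqueness.
Variables (F : fieldType) (g : lieAlgebra F) (A : comAlgType F).
Variable rho : derAction g A.
Local Notation l := (tensor_algebroid rho).
Local Notation G := (schouten_space l).
Local Notation parity := (@schouten_parity F A l).
Local Notation wedge := (@schouten_wedge F A l).
Local Notation d := (ce_diff rho).

Lemma schouten_calculus_unique (br : G -> G -> G)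
    (iota L : G -> cochain g A -> cochain g A) :
  is_superspace parity ->
  is_calculus parity wedge br (@cochain_parity F g A) d iota L ->
  (forall (u : semi l) (w : cochain g A),
     iota (schouten_incl u) w = cochain_iota u w) ->
  iota = @schouten_contr F g A rho /\ L = @schouten_lie F g A rho.
Proof.
move=> superG cal ext.
have ext_cst (f : A) w : iota (f%:A : sym (tensor A g)) w = cochain_mul f w.
  have := ext (0, f) w; rewrite /schouten_incl /= sgen0 add0r => ->.
  by rewrite cochain_iotaE tensor_contr0l add0r.
have ext_gen (t : tensor A g) w : iota (sgen t : sym (tensor A g)) w = tensor_contr t w.
  have := ext (t, 0) w; rewrite /schouten_incl /= scale0r addr0 => ->.
  by rewrite cochain_iotaE mul0 addr0.
have iotaE u w : iota u w = schouten_contr u w.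
  have iotaM (X Y : sym (tensor A g)) v : iota (X * Y : sym _) v = iota X (iota Y v).
    exact: (cal_iota_wedge cal).
  have iotaD (X Y : sym (tensor A g)) v : iota (X + Y : sym _) v = iota X v + iota Y v.
    by have [D _ _ _] := linearDZ (cal_iota_lin cal v); exact: D.
  move: w; move: (u : sym (tensor A g)); apply: sym_ind => [f x y hx hy|s] w.
    (* A calculus is only assumed F-linear in the chain; A-linearity follows from multiplicativity
       and the prescribed value on constants. *)
    rewrite iotaD -[f *: x]mulr_algl iotaM ext_cst hx hy.
    rewrite (schouten_contrD (f%:A * x : sym _)) (schouten_contrM f%:A).
    by rewrite schouten_contr_cst.
  elim: s w => [|t s IHs] w.
    by rewrite mon_nil -[1]scale1r ext_cst (schouten_contr_cst rho 1).
  rewrite mon_cons iotaM ext_gen IHs.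
  by rewrite (schouten_contrM (sgen t)) schouten_contr_gen.
have iota_eq : iota = @schouten_contr F g A rho.
  by apply/funext => u; apply/funext => w; exact: iotaE.
split=> //; apply/funext => u; apply/funext => w.
(* [cal_L_d] determines [L] on homogeneous chains, hence the splitting into even and odd parts. *)
have [u0 [u1 [p0 p1 ->]]] := super_sum superG u.
have [D1 _ _ _] := linearDZ (cal_L_lin cal w).
have [D2 _ _ _] := linearDZ (@schouten_lie_linearl F g A rho w).
rewrite D1 D2 (cal_L_d cal p0) (cal_L_d cal p1) iota_eq.
by rewrite (schouten_lieE _ p0) (schouten_lieE _ p1) /scomm !andbT.
Qed.

End Uniqueness.

Theorem theorem3p1 (F : fieldType) (F_char0 : [pchar F] =i pred0)
    (g : lieAlgebra F) (A : comAlgType F) (rho : derAction g A) :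
  is_algebroid_complex (l := tensor_algebroid rho)
    (@cochain_parity F g A) (ce_diff rho) (@cochain_iota F g A)
  /\
  (forall br : schouten_space (tensor_algebroid rho) ->
               schouten_space (tensor_algebroid rho) ->
               schouten_space (tensor_algebroid rho),
    is_schouten br ->
    exists! c : (schouten_space (tensor_algebroid rho) ->
                   cochain g A -> cochain g A) *
                (schouten_space (tensor_algebroid rho) ->
                   cochain g A -> cochain g A),
      is_graded_calculus
        (@schouten_parity F A (tensor_algebroid rho))
        (@schouten_wedge F A (tensor_algebroid rho)) br
        (@cochain_parity F g A) (ce_diff rho)
        (@schouten_gr F A (tensor_algebroid rho)) (@cochain_gr F g A)
        c.1 c.2
      /\ forall (u : semi (tensor_algebroid rho)) (w : cochain g A),
           c.1 (schouten_incl u) w = cochain_iota u w).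
Proof.
split; first exact: ce_algebroid_complex.
move=> br brP; exists (@schouten_contr F g A rho, @schouten_lie F g A rho); split.
  by split=> [|u w]; [exact: schouten_graded_calculus|exact: schouten_contr_incl].
case=> iota L [cal ext].
(* The superspace structure on chains is taken from the Gerstenhaber structure contained in
   [brP]. *)
have superG := ger_superspace (gger_gerstenhaber (schouten_gerstenhaber brP)).
have [iotaE LE] := schouten_calculus_unique superG (gcal_calculus cal) ext.
by rewrite -iotaE -LE.
Qed.
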